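(* Let $\Omega$ be an open set in $\mathbb{R}^n$, let $f:\Omega\to\mathbb{R}$ be a non-constant locally Lipschitz function on $\Omega$, and let $p$ be a real number. If the zero set $f^{-1}(0)=\{x\in\Omega: f(x)=0\}$ of $f$ is not empty and $$\int_{\Omega\setminus f^{-1}(0)}\bigl|\nabla\log|f(x)|\bigr|^p\,dx<\infty,$$ then $p<n$.
   Context: The gradient of a locally Lipschitz function exists almost everywhere by Rademacher's theorem; on $\Omega\setminus f^{-1}(0)$ one has $|\nabla\log|f||=|\nabla f|/|f|$ almost everywhere, where $|\cdot|$ of a gradient is the Euclidean norm.
   Formalization: ''Non-constant on Ω'' with a non-empty zero set is replaced by: f is non-constant on the connected component of Ω containing some zero of f; for disconnected Ω the original fails (f = 0 on (0,1), f = 1 on (2,3), n = 1, p = 5). *)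

(* Defs.v *)
From HB Require Import structures.
From mathcomp Require Import all_boot all_order all_algebra.
From mathcomp Require Import all_classical all_reals all_analysis.
Import Order.TTheory GRing.Theory Num.Theory.
Import numFieldNormedType.Exports.

Set Implicit Arguments.
Unset Strict Implicit.
Unset Printing Implicit Defensive.

Local Open Scope classical_set_scope.
Local Open Scope ring_scope.

(* R^n is 'rV[R]_n. Its library norm is the sup norm, which has the same open
   sets and the same locally Lipschitz functions as the Euclidean one; only the
   length of the gradient below depends on the choice, and it is Euclidean. *)

(* The sigma-algebra generated by the n coordinates, i.e. the Borel sets (same
   construction as the library's one on n.-tuple T). *)
Definition measure_rV_display : measure_display.
Proof. exact: default_measure_display. Qed.

Section measurable_rV.
Context {R : realType} (n : nat).

Let coord_rV : 'I_n -> 'rV[R]_n -> measurableTypeR R := fun i v => v ord0 i.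

Let rV_set0 : g_sigma_preimage coord_rV set0.
Proof. exact: sigma_algebra0. Qed.

Let rV_setC A : g_sigma_preimage coord_rV A -> g_sigma_preimage coord_rV (~` A).
Proof. exact: sigma_algebraC. Qed.

Let rV_bigcup (F : _^nat) : (forall i, g_sigma_preimage coord_rV (F i)) ->
  g_sigma_preimage coord_rV (\bigcup_i (F i)).
Proof. exact: sigma_algebra_bigcup. Qed.

HB.instance Definition _ := @isMeasurable.Build measure_rV_display
  'rV[R]_n (g_sigma_preimage coord_rV) rV_set0 rV_setC rV_bigcup.

Lemma measurable_coord (i : 'I_n) :
  measurable_fun [set: 'rV[R]_n]
    ((fun v => v ord0 i) : 'rV[R]_n -> measurableTypeR R).
Proof.
move=> _ Y mY; rewrite setTI; apply: sub_sigma_algebra => /=.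
rewrite -bigcup_seq/=; exists i => /=; first by rewrite mem_index_enum.
by exists Y => //; rewrite setTI.
Qed.

Lemma measurable_fun_coordP d (T : measurableType d) (f : T -> 'rV[R]_n) :
  (forall i, measurable_fun [set: T]
    ((fun x => f x ord0 i) : T -> measurableTypeR R)) ->
  measurable_fun [set: T] f.
Proof.
move=> mf _ A mA; rewrite setTI.
have : preimage_set_system [set: T] f (g_sigma_preimage coord_rV)
    `<=` measurable.
  rewrite -g_sigma_preimage_comp.
  apply: smallest_sub; first exact: sigma_algebra_measurable.
  rewrite -bigcup_seq; apply: bigcup_sub => i _ B [C mC <-].
  exact: mf.
by apply; exists A => //; rewrite setTI.
Qed.

End measurable_rV.

Section lebesgue_rV.
Local Open Scope ereal_scope.
Context {R : realType}.

Definition cons_rV n (p : measurableTypeR R * 'rV[R]_n) : 'rV[R]_n.+1 :=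
  row_mx (p.1)%:M p.2.

Definition uncons_rV n (v : 'rV[R]_n.+1) : measurableTypeR R * 'rV[R]_n :=
  (v ord0 ord0, \row_i v ord0 (lift ord0 i)).

Lemma cons_rV0 n p : @cons_rV n p ord0 ord0 = p.1.
Proof.
transitivity (row_mx (p.1)%:M p.2 ord0 (lshift n (@ord0 0))).
  by congr (row_mx _ _ _ _); exact: val_inj.
by rewrite row_mxEl mxE eqxx.
Qed.

Lemma cons_rVS n p (i : 'I_n) : @cons_rV n p ord0 (lift ord0 i) = p.2 ord0 i.
Proof.
transitivity (row_mx (p.1)%:M p.2 ord0 (rshift 1 i)).
  by congr (row_mx _ _ _ _); exact: val_inj.
by rewrite row_mxEr.
Qed.

Lemma cons_rVK n : cancel (@cons_rV n) (@uncons_rV n).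
Proof.
move=> [x v]; rewrite /uncons_rV cons_rV0; congr pair.
by apply/rowP => i; rewrite mxE cons_rVS.
Qed.

Lemma measurable_cons_rV n : measurable_fun [set: _] (@cons_rV n).
Proof.
apply: measurable_fun_coordP => i.
case: (unliftP ord0 i) => [j ->|->].
  under eq_fun do rewrite cons_rVS.
  exact: (measurableT_comp (@measurable_coord R n j) measurable_snd).
under eq_fun do rewrite cons_rV0.
exact: measurable_fst.
Qed.

Lemma measurable_uncons_rV n : measurable_fun [set: _] (@uncons_rV n).
Proof.
apply: measurable_fun_pair; first exact: measurable_coord.
apply: measurable_fun_coordP => i.
under eq_fun do rewrite mxE.
exact: measurable_coord.
Qed.

(* Product of the one-dimensional Lebesgue measure and of a measure on R^n,
   carried to R^(n+1). *)
Section lebesgue_rVS.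
Variables (n : nat) (mu : {sigma_finite_measure set 'rV[R]_n -> \bar R}).

Definition lebesgue_rVS : set 'rV[R]_n.+1 -> \bar R :=
  pushforward (@lebesgue_measure R \x mu) (@cons_rV n).

Let mS : {measure set 'rV[R]_n.+1 -> \bar R} :=
  measure_function_pushforward__canonical__measure_function_Measure
    (@lebesgue_measure R \x mu) (@measurable_cons_rV n).

HB.instance Definition _ := isMeasure.Build _ _ _ lebesgue_rVS
  (measure0 mS) (measure_ge0 mS) (@measure_semi_sigma_additive _ _ _ mS).

Lemma lebesgue_rVSE (A : set (measurableTypeR R)) (B : set 'rV[R]_n) :
  measurable A -> measurable B ->
  lebesgue_rVS (@uncons_rV n @^-1` (A `*` B)) = @lebesgue_measure R A * mu B.
Proof.
move=> mA mB; rewrite /lebesgue_rVS /pushforward -comp_preimage.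
rewrite (_ : _ \o _ = id) ?preimage_id ?product_measure1E//.
by apply/funext => p; exact: cons_rVK.
Qed.

Let lebesgue_rVS_sigma_finite : sigma_finite setT lebesgue_rVS.
Proof.
have /sigma_finiteP[F [TF ndF Foo]] := sigma_finiteT (@lebesgue_measure R).
have /sigma_finiteP[G [TG ndG Goo]] := sigma_finiteT mu.
exists (fun k => @uncons_rV n @^-1` (F k `*` G k)).
  apply/esym; rewrite -subTset => v _.
  have [k _ Fk] : (\bigcup_i F i) (uncons_rV v).1 by rewrite -TF.
  have [l _ Gl] : (\bigcup_i G i) (uncons_rV v).2 by rewrite -TG.
  exists (maxn k l) => //; split.
  - by move: Fk; exact/subsetPset/ndF/leq_maxl.
  - by move: Gl; exact/subsetPset/ndG/leq_maxr.
move=> k; have [mF Fkoo] := Foo k; have [mG Gkoo] := Goo k; split.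
  rewrite -[X in measurable X]setTI; apply: measurable_uncons_rV => //.
  exact: measurableX.
by rewrite lebesgue_rVSE// lte_mul_pinfty// ge0_fin_numE.
Qed.

HB.instance Definition _ := Measure_isSigmaFinite.Build _ _ _ lebesgue_rVS
  lebesgue_rVS_sigma_finite.

End lebesgue_rVS.

(* Lebesgue measure on R^n; R^0 is a point of mass 1. *)
Fixpoint lebesgue_rV n : {sigma_finite_measure set 'rV[R]_n -> \bar R} :=
  match n with
  | 0%N => \d_(0%R : 'rV[R]_0)
  | n'.+1 => lebesgue_rVS (lebesgue_rV n')
  end.

Lemma lebesgue_rV_prod n (A : 'I_n -> set (measurableTypeR R)) :
  (forall i, measurable (A i)) ->
  lebesgue_rV n [set v | forall i, A i (v ord0 i)] =
  \prod_(i < n) @lebesgue_measure R (A i).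
Proof.
elim: n A => [|n IHn] A mA.
  by rewrite big_ord0 /= diracE mem_set// => -[].
have mAS : measurable [set v : 'rV[R]_n | forall i, A (lift ord0 i) (v ord0 i)].
  rewrite (_ : [set v | _] = \bigcap_(i in [set: 'I_n])
      ((fun v : 'rV[R]_n => v ord0 i) @^-1` A (lift ord0 i))); last first.
    by apply/seteqP; split => [v vA i _|v vA i]; [exact: vA|exact: vA i I].
  apply: fin_bigcap_measurable => // i _.
  by rewrite -[X in measurable X]setTI; exact: measurable_coord.
rewrite big_ord_recl -IHn// -lebesgue_rVSE//.
congr (lebesgue_rVS _ _); apply/seteqP; split => v.
- move=> vA; split; first exact: vA.
  by move=> i /=; rewrite mxE; exact: vA.
- move=> [A0 AS] i; case: (unliftP ord0 i) => [j ->|-> //].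
  by have := AS j; rewrite /= mxE.
Qed.

End lebesgue_rV.

Section functions_on_open_sets.
Context {R : realType} (n : nat).
Implicit Types (Omega A : set 'rV[R]_n) (f g : 'rV[R]_n -> R).

(* A function Omega -> R is given by any of its extensions to R^n: what follows
   uses it on the open set Omega only. *)

Definition locally_lipschitz Omega f : Prop :=
  forall x, Omega x ->
    exists2 U, nbhs x U & [lipschitz f y | y in U `&` Omega].

Definition nonconstant_on A f : Prop :=
  exists x y, [/\ A x, A y & f x <> f y].

Definition zero_set Omega f : set 'rV[R]_n := [set x | Omega x /\ f x = 0].

(* On a disconnected open set Omega, a function may be non-constant and yet
   vanish identically on one component and equal 1 on all the others, so that
   log |f| has gradient 0 off the zero set. The non-constancy that matters is
   thus the one on the connected component of a zero of f; when Omega is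
   connected it is plain non-constancy. *)
Lemma zero_nonconstant_connected Omega f :
  connected Omega -> zero_set Omega f !=set0 -> nonconstant_on Omega f ->
  exists2 x0, zero_set Omega f x0 &
    nonconstant_on (connected_component Omega x0) f.
Proof.
move=> Oc [x0 x0Z] fnc; exists x0 => //.
by rewrite connected_component_id//; case: x0Z.
Qed.

(* The row of partial derivatives: the gradient of g wherever g is
   differentiable, i.e. almost everywhere if g is locally Lipschitz. *)
Definition gradient g (x : 'rV[R]_n) : 'rV[R]_n :=
  \row_i 'D_(delta_mx ord0 i) g x.

Definition euclidean_norm (v : 'rV[R]_n) : R :=
  Num.sqrt (\sum_(i < n) v ord0 i ^+ 2).

End functions_on_open_sets.

(* Main.v *)
Require Import Defs.
From HB Require Import structures.
From mathcomp Require Import all_boot all_order all_algebra.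
From mathcomp Require Import all_classical all_reals all_analysis.
From mathcomp Require Import measurable_realfun ring lra.
Import Order.TTheory GRing.Theory Num.Theory.
Import numFieldNormedType.Exports.

Set Implicit Arguments.
Unset Strict Implicit.
Unset Printing Implicit Defensive.

Local Open Scope classical_set_scope.
Local Open Scope ring_scope.

(** Suppose p >= n and put w = ln |f|. Near a boundary point of the zero set
    there is an open cube B on which f does not vanish but whose closure touches
    a zero z of f. The homotheties of ratio 2^-k centred at z map B to nested
    open cubes P_k shrinking to z. As f is Lipschitz, w <= C - k ln 2 on P_k.
    On a cube of side l <= 1, the Poincare inequality and
    l a <= eps + eps^(1-p) (l a)^p with a = |grad w| bound the mean oscillation
    of w by n (eps + eps^(1-p) \int_{P_k} a^p), where p >= n enters through
    l^p <= l^n. If a^p is integrable this tends to 0, so passing from P_k to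
    P_{k+1} most values of w drop by at most (ln 2)/2, against the bound on w. *)

(** * Lipschitz functions of one variable *)

(** At p = n the integral of a^p over a cube is invariant under homothety, so scaling alone gains
    nothing; smallness comes only from the cubes shrinking to a point that lies in none of them. The
    bound with eps stands in for Hoelder's inequality: it is linear in the integral of a^p, and eps
    is fixed by the oscillation to be reached. Oscillation is the double integral of |w x - w y|
    over P_k x P_k rather than a deviation from a mean, a form that makes sense before w, unbounded
    near z, is known to be integrable. Accordingly the induction follows a level that w reaches on
    at least half of each cube, a kind of median. The rate (ln 2)/2 is just a positive rate below
    the forced rate ln 2. Cubes are balls of the sup norm, hence products of intervals, so Tonelli
    allows an induction on the dimension. Partial derivatives are total functions with a default
    value where the limit fails, and their measurability is established in that form. *)

Section lipschitz_ftc.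
Context {R : realType}.
Local Notation lambda := (@lebesgue_measure R).

Lemma stieltjes_itv (F : cumulative R R) (a b : R) : a <= b ->
  lebesgue_stieltjes_measure F `]a, b]%classic = (F b - F a)%:E.
Proof.
move=> ab; rewrite /lebesgue_stieltjes_measure /measure_extension.
rewrite measurable_mu_extE/=; last exact: is_ocitv.
by rewrite wlength_itv_bnd.
Qed.

(** The contraction bound keeps the slopes of t + s w t between 0 and 2, so half of it is
    nondecreasing and continuous. The sign [s] serves both halves of the decomposition used next. *)
Lemma contraction_cumulative (s : R) (w : R -> R) : `|s| = 1 ->
  (forall x y, `|w x - w y| <= `|x - y|) ->
  exists F : cumulative R R, forall t, F t = 2^-1 * (t + s * w t).
Proof.
move=> s1 wL; pose F t := 2^-1 * (t + s * w t).
have sw x y : `|s * w x - s * w y| <= `|x - y|.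
  by rewrite -mulrBr normrM s1 mul1r.
have Fnd : nondecreasing F.
  move=> x y xy; rewrite /F ler_pM2l ?invr_gt0//.
  have := sw y x; rewrite [leRHS]ger0_norm ?subr_ge0// ler_norml => /andP[+ _].
  by lra.
have Fcont : continuous F.
  move=> x; apply/cvgrPdist_le => e e0; near=> y.
  have -> : F x - F y = 2^-1 * ((x - y) + (s * w x - s * w y)).
    by rewrite /F; field.
  rewrite normrM ger0_norm// ler_pdivrMl//.
  apply: le_trans (ler_normD _ _) _.
  have xye : `|x - y| <= e by near: y; exact: cvgr_dist_le.
  by have := sw x y; lra.
have Frc := right_continuousW Fcont.
pose HF := isCumulative.Build R _ R F Fnd Frc.
pose G : cumulative R R := HB.pack F HF.
by exists G.
Unshelve. all: by end_near. Qed.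

(* The two increasing functions (t + w t) / 2 and (t - w t) / 2 add up to the
   identity, so the Stieltjes measure of the first is dominated by Lebesgue
   measure; its Radon-Nikodym density is (1 + w') / 2 almost everywhere. *)
Lemma contraction_ae_derivable (w : R -> R) (a b : R) : a <= b ->
  (forall x y, `|w x - w y| <= `|x - y|) ->
  exists g : R -> R, [/\ lambda.-integrable `]a, b] (EFin \o g),
    {ae lambda, forall x, `]a, b[%classic x -> is_derive x 1 w (g x)} &
    (w b - w a)%:E = (\int[lambda]_(x in `]a, b]) (g x)%:E)%E].
Proof.
move=> ab wL.
have [F FE] : exists F : cumulative R R, forall t, F t = 2^-1 * (t + 1 * w t).
  by apply: contraction_cumulative; rewrite ?normr1.
have [F' F'E] : exists F : cumulative R R, forall t,
    F t = 2^-1 * (t + -1 * w t).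
  by apply: contraction_cumulative; rewrite ?normrN1.
pose nu : {measure set (measurableTypeR R) -> \bar R} :=
  lebesgue_stieltjes_measure F.
pose nu' : {measure set (measurableTypeR R) -> \bar R} :=
  lebesgue_stieltjes_measure F'.
have nuE c d : c <= d -> nu `]c, d]%classic = (F d - F c)%:E.
  exact: stieltjes_itv.
have nu'E c d : c <= d -> nu' `]c, d]%classic = (F' d - F' c)%:E.
  exact: stieltjes_itv.
have nuD A : measurable A -> lambda A = (nu A + nu' A)%E.
  move=> mA; transitivity (measure_add nu nu' A); last exact: measure_addE.
  apply: lebesgue_measure_unique => // X /ocitvP[->|[[c d] /= cd ->]].
    by rewrite !measure0.
  rewrite [RHS]measure_addE nuE ?nu'E ?(ltW cd)//.
  rewrite lebesgue_measure_itv/= lte_fin cd -EFinB -EFinD !FE !F'E.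
  by congr EFin; field.
have mI : measurable (`]a, b]%classic : set (measurableTypeR R)) by [].
have nuI : (nu `]a, b]%classic < +oo)%E by rewrite nuE// ltry.
(* Domination follows from [nu] being at most [nu + nu' = lambda]; restricting to []a, b]] makes the
   measure finite, so that its density is integrable. *)
have dom : mfrestr mI nuI `<< lambda.
  apply/null_content_dominatesP => A mA A0.
  apply/eqP; rewrite eq_le measure_ge0 andbT.
  apply: (@le_trans _ _ (nu A)); first exact: measureIl.
  apply: (@le_trans _ _ (nu A + nu' A)%E); first by rewrite leeDl.
  by rewrite -nuD// A0.
have [h [h0 hfin hint hE]] := radon_nikodym_sigma_finite dom.
pose f := fine \o h.
have fE : EFin \o f = h by apply/funext => x; rewrite /f/= fineK.
have fint : lambda.-integrable setT (EFin \o f) by rewrite fE.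
have floc : locally_integrable setT f by apply: open_integrable_locally => //; exact: openT.
have Fint y : a <= y <= b ->
    (\int[lambda]_(t in `]a, y]) f t)%R = F y - F a.
  move=> /andP[ay yb].
  rewrite /Rintegral.
  transitivity (fine (mfrestr mI nuI `]a, y]%classic)).
    by rewrite hE//; congr fine; apply: eq_integral => x _; rewrite -fE.
  rewrite /mfrestr /mrestr setIidl; last first.
    by apply: subset_itvl; rewrite bnd_simp.
  by rewrite nuE.
have fintI : lambda.-integrable `]a, b] (EFin \o f) by exact: integrableS fint.
have f2int : lambda.-integrable `]a, b] (EFin \o (fun x => 2 * f x)).
  rewrite (_ : _ \o _ = (fun x => 2%:E * (EFin \o f) x)%E).
    exact: integrableZl.
  by apply/funext => x; rewrite /= EFinM.
have lab : lambda `]a, b]%classic = (b - a)%:E.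
  rewrite lebesgue_measure_itv/= lte_fin -EFinB.
  by case: ltgtP ab => // -> _; rewrite subrr.
have intc : (\int[lambda]_(x in `]a, b]) (cst (1 : R) x)%:E = (b - a)%:E)%E.
  by rewrite -lab -[RHS]mul1e -integral_cst.
have cint : lambda.-integrable `]a, b] (EFin \o (cst 1 : R -> R)).
  apply/integrableP; split; first exact/measurable_EFinP.
  under eq_integral do rewrite /= normr1.
  by rewrite integral_cst//= mul1e [X in (X < _)%E]lab ltry.
(* Here [w t = 2 * F t - t], and [f] is the density of [F]. *)
exists (fun x => 2 * f x - 1); split.
- rewrite (_ : _ \o _ = (EFin \o (fun x => 2 * f x)%R) \- (EFin \o (cst 1%R)))%E.
    exact: integrableB.
  by apply/funext => x; rewrite /= EFinB.
- have fint' y : lambda.-integrable [set` Interval (BRight a) (BRight y)] (EFin \o f).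
    exact: integrableS fint.
  have := FTC1 fint' floc.
  apply: filterS; first exact: (ae_filter_ringOfSetsType lambda).
  move=> x + /=; rewrite in_itv/= => + /andP[ax xb].
  move=> /(_ ax)[].
  set K := (fun y => _) => dK K'.
  (* [K y] is known to be [F y - F a] only for [y] between [a] and [b]; a local identity suffices
     for the derivative at an interior point. *)
  have KE : \forall y \near x, 2 * K y + (2 * F a - y) = w y.
    near=> y; rewrite /K Fint ?FE; first by field.
    suff : y \in `]a, b[ by rewrite in_itv/= => /andP[/ltW-> /ltW->].
    by near: y; apply: near_in_itvoo; rewrite in_itv/= ax xb.
  apply: near_eq_is_derive KE _.
  have KD : is_derive x 1 K (f x).
    by apply: DeriveDef; [exact: dK|rewrite -derive1E].
  have -> : 2 * f x - 1 = 2 *: f x + (0 - 1) by rewrite sub0r.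
  exact: is_deriveD.
- under eq_integral do rewrite EFinB.
  rewrite (integralB_EFin _ f2int cint)// intc.
  under eq_integral do rewrite EFinM.
  rewrite integralZl// -[X in (2%:E * X)%E]fineK; last exact: integrable_fin_num.
  rewrite -[fine _]/(\int[lambda]_(x in `]a, b]) f x)%R Fint ?ab ?lexx//.
  by rewrite -EFinM -EFinB !FE; congr EFin; field.
Unshelve. all: by end_near. Qed.

(** Clamping the argument to [a, b] and dividing by [M = |L| + 1], positive whatever the sign of
    [L], turns [u] into a contraction of the whole line. The density found for it gives ['D_1 u]
    only almost everywhere, hence the measurability hypothesis. *)
Lemma lipschitz_dist_le_integral_derive (u : R -> R) (L a b : R) : a <= b ->
  (forall x y, a <= x <= b -> a <= y <= b -> `|u x - u y| <= L * `|x - y|) ->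
  measurable_fun `]a, b[ ('D_1 u) ->
  (`|u b - u a|%:E <= \int[lambda]_(x in `]a, b[) `|'D_1 u x|%:E)%E.
Proof.
move=> ab uL mu.
pose M : R := `|L| + 1.
have M0 : 0 < M by rewrite ltr_pwDr.
pose c (x : R) := Num.max a (Num.min b x).
have cab x : a <= c x <= b.
  by rewrite /c le_max lexx ge_max ab ge_min lexx.
have cid x : a <= x <= b -> c x = x.
  by move=> /andP[ax xb]; rewrite /c (min_idPr xb) (max_idPr ax).
have cL x y : `|c x - c y| <= `|x - y|.
  wlog xy : x y / x <= y.
    by move=> H; case: (leP x y) => [/H//|/ltW /H]; rewrite distrC (distrC y).
  rewrite [leRHS]distrC [leRHS]ger0_norm ?subr_ge0// ler_norml.
  have cP t : [\/ c t = a /\ t <= a, c t = t | c t = b /\ b <= t].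
    rewrite /c; case: (leP b t) => [bt|_].
      by rewrite (max_idPr ab); constructor 3.
    by case: (leP a t) => ta; [constructor 2|constructor 1; split=> //; exact: ltW].
  move: (cab x) (cab y).
  by case: (cP x) => [[-> ?]|->|[-> ?]]; case: (cP y) => [[-> ?]|->|[-> ?]];
    move=> /andP[? ?] /andP[? ?]; lra.
pose w x : R := M^-1 * u (c x).
have wL x y : `|w x - w y| <= `|x - y|.
  rewrite /w -mulrBr normrM gtr0_norm ?invr_gt0// ler_pdivrMl//.
  apply: (le_trans (uL _ _ (cab x) (cab y))).
  apply: (@le_trans _ _ (M * `|c x - c y|)); last by rewrite ler_pM2l.
  by rewrite ler_wpM2r// (le_trans (ler_norm _))// lerDl.
have [g [gint gae gE]] := contraction_ae_derivable ab wL.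
have mg : measurable_fun `]a, b] g.
  by apply/measurable_EFinP; exact: measurable_int gint.
have uE x : a <= x <= b -> u x = M * w x.
  by move=> xab; rewrite /w cid// mulVKf// gt_eqF.
rewrite !uE ?lexx ?ab// -mulrBr normrM gtr0_norm// EFinM.
apply: (@le_trans _ _ (M%:E * \int[lambda]_(x in `]a, b[) `|(g x)%:E|)%E).
  rewrite lee_pmul2l// -abse_EFin gE.
  rewrite -(@integral_itv_bndoo _ a b _ false false).
    by apply: le_abse_integral => //; exact: measurable_int gint.
  apply: measurableT_comp => //; apply/measurable_EFinP.
  by apply: measurable_funS mg => //; apply: subset_itvl; rewrite bnd_simp.
have mg' : measurable_fun `]a, b[ g.
  by apply: measurable_funS mg => //; apply: subset_itvl; rewrite bnd_simp.
rewrite -ge0_integralZl//=.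
- apply: ae_ge0_le_integral => //.
  + by move=> x _; rewrite mule_ge0// lee_fin ltW.
  + apply: measurable_funeM => //; apply/measurable_EFinP.
    exact: measurableT_comp.
  + by apply/measurable_EFinP; exact: measurableT_comp.
  + move: gae; apply: filterS; first exact: (ae_filter_ringOfSetsType lambda).
    move=> x /= dw xab; have wg := dw xab.
    rewrite -EFinM lee_fin -(gtr0_norm M0) -normrM.
    suff /@derive_val -> : is_derive x 1 u (M * g x) by [].
    apply: (@near_eq_is_derive _ _ _ (M *: w)).
      near=> y; rewrite uE//.
      suff : y \in `]a, b[ by rewrite in_itv/= => /andP[/ltW-> /ltW->].
      by near: y; exact: near_in_itvoo.
- by apply/measurable_EFinP; exact: measurableT_comp.
- by rewrite lee_fin ltW.
Unshelve. all: by end_near. Qed.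
End lipschitz_ftc.

(** * Measurability of directional derivatives *)

Section measurable_derive.
Context {R : realType}.

Lemma near_rat (x : R) (P : set R) : nbhs x P -> exists q : rat, P (ratr q).
Proof.
rewrite nbhsE => -[U [oU Ux] UP].
have [z [Uz [q _ qz]]] := @dense_rat R U (ex_intro _ _ Ux) oU.
by exists q; rewrite qz; exact: UP.
Qed.

(* By continuity in h, the Cauchy criterion at 0 may be tested on rational h,
   so the set of convergence is measurable; off it, lim is the constant
   [point]. *)
Lemma measurable_lim_dnbhs0 d (T : measurableType d) (D : set T)
    (q : R -> T -> R) : measurable D ->
  (forall h, measurable_fun D (q h)) ->
  (forall x, D x -> \forall h \near 0^', {for h, continuous (q^~ x)}) ->
  measurable_fun D (fun x => lim (q h x @[h --> 0^'])).
Proof.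
move=> mD mq cq.
(* The anchor 1/(m+2) lies strictly inside the punctured ball of radius 1/(m+1), so the Cauchy
   criterion compares every rational point of that ball with this single one. *)
pose G (j m : nat) (r : rat) : set T :=
  if (0 < `|ratr r : R| < m.+1%:R^-1)
  then D `&` [set x | `|q m.+2%:R^-1 x - q (ratr r) x| <= j.+1%:R^-1] else D.
pose E := \bigcap_j \bigcup_m \bigcap_r G j m r.
have mE : measurable E.
  apply: bigcap_measurableType => j _; apply: bigcup_measurable => m _.
  rewrite -[X in measurable X]setCK setC_bigcap; apply: measurableC.
  apply: bigcupT_measurable_rat => r; apply: measurableC.
  rewrite /G; case: ifP => // _.
  apply: measurable_fun_le => //.
  by apply: measurableT_comp => //; exact: measurable_funB.
have cvgE x : D x -> E x -> cvg (q h x @[h --> 0^']).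
  move=> Dx Ex; apply/cauchy_cvgP; apply: cauchy_exP => e e0.
  near \oo => j.
  have je : j.+1%:R^-1 < e.
    by near: j; exact: near_infty_natSinv_lt (PosNum e0).
  have [m _ Gm] := Ex j I.
  exists (q m.+2%:R^-1 x).
  suff : \forall h \near 0^', `|q m.+2%:R^-1 x - q h x| < e by [].
  near=> h; apply: le_lt_trans je.
  (* If a real h violated the bound, continuity of the quotient at h would produce a rational
     violating it too, against [Gm]. *)
  rewrite leNgt; apply/negP => qh.
  have ch : {for h, continuous (q^~ x)} by near: h; exact: (cq x Dx).
  have : \forall k \near h, 0 < `|k| < m.+1%:R^-1 /\
      j.+1%:R^-1 < `|q m.+2%:R^-1 x - q k x|.
    have h0 : 0 < `|h| by rewrite normr_gt0; near: h; exact: nbhs_dnbhs_neq.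
    have hm : `|h| < m.+1%:R^-1 by near: h; apply: dnbhs0_lt; rewrite invr_gt0.
    near=> k; split; [apply/andP; split|]; near: k.
    - exact: (cvgr_gt _ (@norm_continuous _ _ h)).
    - exact: (cvgr_lt _ (@norm_continuous _ _ h)).
    - apply: (cvgr_gt _ _ _ qh); apply: cvg_norm.
      by apply: cvgB; [exact: cvg_cst|exact: ch].
  move=> /near_rat[r [rm]]; have := Gm r I; rewrite /G rm => -[_ /=].
  by rewrite leNgt => /negP.
have Ecvg x : D x -> cvg (q h x @[h --> 0^']) -> E x.
  move=> Dx /cvg_ex[l ql] j _.
  have j0 : 0 < j.+1%:R^-1 / 2 :> R by rewrite divr_gt0.
  have /cvgrPdist_lt/(_ _ j0) := ql.
  rewrite near_withinE => /nbhs_ballP[e /= e0 eq].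
  near \oo => m.
  have me : m.+1%:R^-1 < e.
    by near: m; exact: near_infty_natSinv_lt (PosNum e0).
  exists m => // r _; rewrite /G; case: ifP => // /andP[r0 rm]; split=> //=.
  have qr : `|l - q (ratr r) x| < j.+1%:R^-1 / 2.
    apply: eq; last by rewrite -normr_gt0.
    by rewrite /ball/= sub0r normrN (lt_trans rm).
  have qm : `|l - q m.+2%:R^-1 x| < j.+1%:R^-1 / 2.
    apply: eq; last by rewrite /= gt_eqF ?invr_gt0.
    rewrite /ball/= sub0r normrN gtr0_norm ?invr_gt0// (lt_trans _ me)//.
    by rewrite ltf_pV2 ?posrE// ltr_nat.
  apply: (le_trans (ler_distD l _ _)); rewrite distrC.
  by rewrite (splitr j.+1%:R^-1) lerD// ltW.
rewrite -(setDUK (@subIsetl _ D E)); apply/measurable_funU.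
- exact: measurableI.
- by apply: measurableD => //; exact: measurableI.
split.
- apply: (@measurable_fun_cvg _ _ _ _ (fun n => q n.+1%:R^-1)).
    by move=> m; apply: measurable_funS (mq _) => //; exact: subIsetl.
  move=> x [Dx Ex]; have qx := cvgE _ Dx Ex.
  have h0 : n.+1%:R^-1 @[n --> \oo] --> (0 : R)^'.
    move=> A /nbhs_ballP[e /= e0 eA].
    suff : \forall n \near \oo, A n.+1%:R^-1 by [].
    near=> n; apply: eA; last by rewrite /= gt_eqF ?invr_gt0.
    rewrite /ball/= sub0r normrN gtr0_norm ?invr_gt0//.
    by near: n; exact: near_infty_natSinv_lt (PosNum e0).
  exact: cvg_comp h0 qx.
- apply: (@eq_measurable_fun _ _ _ _ _ (cst point)); last exact: measurable_cst.
  move=> x; rewrite inE => -[Dx nE]; apply/esym; apply: dvgP => qx.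
  by apply: nE; split=> //; exact: Ecvg.
Unshelve. all: by end_near. Qed.
End measurable_derive.

(** * Open sets, continuous functions and partial derivatives on R^n *)

Section rV_measurable.
Context {R : realType} {n : nat}.
Implicit Types (c v : 'rV[R]_n) (r : R) (B : set 'rV[R]_n).

Lemma ball_rVP c r v : 0 < r ->
  ball c r v <-> forall i, `|v 0 i - c 0 i| < r.
Proof.
move=> r0; split=> [[_ cv] i|cv]; first by rewrite distrC; exact: cv.
by split=> // i j; rewrite ord1 /ball/= distrC.
Qed.

Lemma ball_rVE c r : 0 < r ->
  ball c r = [set v | forall i, `]c 0 i - r, c 0 i + r[%classic (v 0 i)].
Proof.
move=> r0; apply/seteqP; split=> v.
  by move=> /(ball_rVP _ _ r0) cv i; rewrite /= in_itv/= -ltr_distl.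
by move=> cv; apply/(ball_rVP _ _ r0) => i; have := cv i; rewrite /= in_itv/= -ltr_distl.
Qed.

Lemma measurable_ball_rV c r : 0 < r -> measurable (ball c r).
Proof.
move=> r0; rewrite ball_rVE//.
rewrite [X in measurable X](_ : _ = \bigcap_(i in [set: 'I_n])
    ((fun v : 'rV[R]_n => v ord0 i) @^-1` `]c 0 i - r, c 0 i + r[%classic)).
  apply: fin_bigcap_measurable => // i _.
  by rewrite -[X in measurable X]setTI; exact: measurable_coord.
by apply/seteqP; split => [v vA i _|v vA i]; [exact: vA|exact: vA i I].
Qed.

Lemma lebesgue_ball_rV c r : 0 < r ->
  lebesgue_rV n (ball c r) = ((r *+ 2) ^+ n)%:E.
Proof.
move=> r0; rewrite ball_rVE//.
rewrite (@lebesgue_rV_prod R n (fun i => `]c 0 i - r, c 0 i + r[%classic) _)//.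
transitivity (\prod_(i < n) (r *+ 2)%:E)%E.
  apply: eq_bigr => i _; rewrite lebesgue_measure_itv/= lte_fin ltrD2l gtrN//.
  by rewrite -EFinB; congr EFin; ring.
by rewrite prodEFin prodr_const card_ord.
Qed.

(** The sigma-algebra is generated by coordinates, so [B] is written as the countable union of the
    cubes it contains with rational centre and radius 1/(k+1). *)
Lemma open_measurable_rV B : open B -> measurable B.
Proof.
move=> oB.
pose F (qk : 'rV[rat]_n * nat) : set 'rV[R]_n :=
  let b := ball (map_mx ratr qk.1 : 'rV[R]_n) (qk.2.+1%:R^-1 : R) in
  if `[< b `<=` B >] then b else set0.
have -> : B = \bigcup_qk F qk.
  apply/seteqP; split=> [x Bx|x [qk _]]; last first.
    by rewrite /F; case: asboolP => // bB; exact: bB.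
  have /nbhs_ballP[e /= e0 eB] := open_nbhs_nbhs (conj oB Bx).
  have e20 : 0 < e / 2 by rewrite divr_gt0.
  near \oo => k.
  have ke : k.+1%:R^-1 < e / 2.
    by near: k; exact: near_infty_natSinv_lt (PosNum e20).
  have k0 : 0 < k.+1%:R^-1 :> R by rewrite invr_gt0.
  have H i : exists q : rat, `|ratr q - x 0 i| < k.+1%:R^-1.
    have : \forall y \near x 0 i, `|y - x 0 i| < k.+1%:R^-1.
      by near do rewrite distrC; exact: nbhsx_ballx.
    by move=> /near_rat.
  have [q qP] := choice H.
  exists (\row_i q i, k) => //; rewrite /F asboolT/=.
    apply/ball_rVP => // i; rewrite !mxE distrC; exact: qP.
  apply: subset_trans eB => y yb; apply/ball_rVP => // i.
  have /(ball_rVP _ _ k0)/(_ i) := yb; rewrite !mxE => yq.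
  apply: le_lt_trans (ler_distD (ratr (q i)) _ _) _.
  by rewrite (splitr e) ltrD// (lt_trans _ ke).
apply: countable_bigcupT_measurable => // -[q k]; rewrite /F; case: ifP => // _.
by apply: measurable_ball_rV; rewrite invr_gt0.
Unshelve. all: by end_near. Qed.

Lemma continuous_measurable_rV B (w : 'rV[R]_n -> R) : open B ->
  {in B, continuous w} -> measurable_fun B w.
Proof.
move=> oB cw; have mB := open_measurable_rV oB.
apply: (measurability _ (RGenOpens.measurableE R)).
move=> _ [_ [a [b ->] <-]]; apply: open_measurable_rV.
rewrite openE => x [Bx wx]; apply: filterI; first exact: open_nbhs_nbhs.
by apply: cw; [rewrite inE|exact/open_nbhs_nbhs].
Qed.

Let measurable_derive_total B (w : 'rV[R]_n -> R) (v : 'rV[R]_n) : open B ->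
  {in B, continuous w} -> measurable_fun setT w ->
  measurable_fun B (fun x => 'D_v w x).
Proof.
move=> oB cw mw; apply: measurable_lim_dnbhs0; first exact: open_measurable_rV.
  move=> h; apply: measurable_funS (measurableT) _ _ => //.
  apply: measurable_funM => //; apply: measurable_funB => //.
  apply: measurableT_comp => //.
  apply: measurable_fun_coordP => i.
  under eq_fun do rewrite /= !mxE.
  by apply: measurable_funD => //; exact: measurable_coord.
move=> x; rewrite -inE => Bx.
have lv (h : R) : (k *: v + x) @[k --> h] --> h *: v + x.
  by apply: cvgD; [apply: cvgZ; [exact: cvg_id|exact: cvg_cst]|exact: cvg_cst].
have nB : \forall h \near (0 : R), B (h *: v + x).
  apply: lv; rewrite scale0r add0r; apply: open_nbhs_nbhs; split=> //.
  by rewrite inE in Bx.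
near=> h.
have h0 : h != 0 by near: h; exact: nbhs_dnbhs_neq.
have Bh : h *: v + x \in B by rewrite inE; near: h; exact: (nbhs_dnbhs nB).
apply: cvgZ; first by apply: cvgV => //; exact: cvg_id.
by apply: cvgB; [exact: cvg_comp (lv h) (cw _ Bh)|exact: cvg_cst].
Unshelve. all: by end_near. Qed.

Lemma near_eq_patch B (w : 'rV[R]_n -> R) x : open B -> B x ->
  \forall y \near x, (w \_ B) y = w y.
Proof.
move=> oB Bx; have nB : nbhs x B by exact: open_nbhs_nbhs.
by apply: filterS nB => y By; rewrite patchE mem_set.
Qed.

(** Difference quotients at points of [B] may evaluate [w] outside [B]. Extension by 0 makes [w]
    measurable everywhere and, [B] being open, changes no derivative in [B]. *)
Lemma measurable_derive_rV B (w : 'rV[R]_n -> R) (v : 'rV[R]_n) : open B ->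
  {in B, continuous w} -> measurable_fun B ('D_v w).
Proof.
move=> oB cw; apply: (@eq_measurable_fun _ _ _ _ _ (fun x => 'D_v (w \_ B) x)).
  by move=> x; rewrite inE => Bx; apply: near_eq_derive; exact: near_eq_patch.
apply: measurable_derive_total => //.
  move=> x xB; have Bx : B x by rewrite inE in xB.
  have wE := near_eq_patch w oB Bx.
  rewrite /continuous_at (nbhs_singleton wE).
  have Ew : {near x, w =1 (w \_ B)} by apply: filterS wE => y ->.
  exact: cvg_trans (near_eq_cvg Ew) (cw _ xB).
apply: (measurable_restrictT w (open_measurable_rV oB)).1.
exact: continuous_measurable_rV.
Qed.
End rV_measurable.

(** * The Poincare inequality on cubes *)

Section tonelli_on_sets.
Local Open Scope ereal_scope.
Context d1 d2 (T1 : measurableType d1) (T2 : measurableType d2) (R : realType).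
Variables (m1 : {sigma_finite_measure set T1 -> \bar R})
          (m2 : {sigma_finite_measure set T2 -> \bar R}).
Variables (A : set T1) (B : set T2) (mA : measurable A) (mB : measurable B).
Variable f : T1 * T2 -> \bar R.
Hypothesis mf : measurable_fun setT f.
Hypothesis f0 : forall z, 0 <= f z.

Lemma measurable_integral_snd :
  measurable_fun setT (fun x => \int[m2]_(y in B) f (x, y)).
Proof.
rewrite (_ : (fun x => _) = fubini_F m2 (f \_ (setT `*` B))).
  apply: measurable_fun_fubini_tonelli_F.
    apply: (measurable_restrictT f (measurableX measurableT mB)).1.
    exact: measurable_funTS.
  by apply: erestrict_ge0 => z _; exact: f0.
apply/funext => x; rewrite /fubini_F [LHS]integral_mkcond; apply: eq_integral => y _.
by rewrite !patchE in_setX in_setT.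
Qed.

Lemma integral_setX :
  \int[m1 \x m2]_(z in A `*` B) f z =
  \int[m1]_(x in A) \int[m2]_(y in B) f (x, y).
Proof.
rewrite [LHS](integral_mkcond (A `*` B)) fubini_tonelli1; last 2 first.
- apply: (measurable_restrictT f (measurableX mA mB)).1.
  exact: measurable_funTS.
- by apply: erestrict_ge0 => z _; exact: f0.
rewrite [RHS]integral_mkcond; apply: eq_integral => x _.
rewrite /fubini_F [RHS]patchE; case: ifPn => xA.
  rewrite [RHS]integral_mkcond; apply: eq_integral => y _.
  by rewrite !patchE in_setX xA.
by apply: integral0_eq => y _; rewrite patchE in_setX (negbTE xA).
Qed.

End tonelli_on_sets.

Lemma tonelli_set d1 d2 (T1 : measurableType d1) (T2 : measurableType d2)
    (R : realType) (m1 : {sigma_finite_measure set T1 -> \bar R})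
    (m2 : {sigma_finite_measure set T2 -> \bar R}) (A : set T1) (B : set T2)
    (f : T1 * T2 -> \bar R) : measurable A -> measurable B ->
  measurable_fun setT f -> (forall z, 0 <= f z)%E ->
  (\int[m1]_(x in A) \int[m2]_(y in B) f (x, y) =
   \int[m2]_(y in B) \int[m1]_(x in A) f (x, y))%E.
Proof.
move=> mA mB mf f0.
rewrite -integral_setX// [LHS](integral_mkcond (A `*` B)) fubini_tonelli2; last 2 first.
- apply: (measurable_restrictT f (measurableX mA mB)).1.
  exact: measurable_funTS.
- by apply: erestrict_ge0 => z _; exact: f0.
rewrite [RHS]integral_mkcond; apply: eq_integral => y _.
rewrite /fubini_G [RHS]patchE; case: ifPn => yB.
  rewrite [RHS]integral_mkcond; apply: eq_integral => x _.
  by rewrite !patchE in_setX yB andbT.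
by apply: integral0_eq => x _; rewrite patchE in_setX (negbTE yB) andbF.
Qed.

Section lebesgue_rV_ball.
Context {R : realType}.

Definition tail_rV n (c : 'rV[R]_n.+1) : 'rV[R]_n := (uncons_rV c).2.

Lemma ball_cons_rV n (c : 'rV[R]_n.+1) (r s : R) p : 0 < r ->
  ball c r (cons_rV (s, p)) <->
  `]c 0 0 - r, c 0 0 + r[%classic s /\ ball (tail_rV c) r p.
Proof.
move=> r0; split.
  move=> /(ball_rVP _ _ r0) H; split.
    by have := H ord0; rewrite cons_rV0 /= in_itv/= -ltr_distl.
  by apply/ball_rVP => // i; have := H (lift ord0 i); rewrite cons_rVS mxE.
move=> [H0 /(ball_rVP _ _ r0) H]; apply/ball_rVP => // i.
case: (unliftP ord0 i) => [j ->|->]; last first.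
  by rewrite cons_rV0 ltr_distl; move: H0; rewrite /= in_itv.
by have := H j; rewrite cons_rVS mxE.
Qed.

Lemma integral_ball_rVS n (c : 'rV[R]_n.+1) (r : R) (g : 'rV[R]_n.+1 -> \bar R) :
  0 < r -> measurable_fun setT g -> (forall x, 0 <= g x)%E ->
  (\int[lebesgue_rV n.+1]_(v in ball c r) g v =
   \int[@lebesgue_measure R]_(s in `](c ord0 ord0 - r)%R, (c ord0 ord0 + r)%R[)
     \int[lebesgue_rV n]_(p in ball (tail_rV c) r) g (cons_rV (s, p)))%E.
Proof.
move=> r0 mg g0.
have mc := @measurable_cons_rV R n.
rewrite -(@integral_setX _ _ _ _ _ (@lebesgue_measure R) (lebesgue_rV n) _ _ _ _
  (g \o @cons_rV R n)) //; last 3 first.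
- exact: measurable_ball_rV.
- exact: measurableT_comp.
- by move=> z; exact: g0.
rewrite (_ : _ `*` _ = @cons_rV R n @^-1` ball c r); last first.
  by apply/seteqP; split=> -[s p] /ball_cons_rV; exact.
have := @ge0_integral_pushforward _ _ _ _ _ _ mc (@lebesgue_measure R \x lebesgue_rV n)%E
  (ball c r) g.
apply=> //.
- exact: measurable_ball_rV.
- exact: measurable_funTS.
Qed.

End lebesgue_rV_ball.

Section poincare.
Context {R : realType}.
Local Notation lambda := (@lebesgue_measure R).

Definition set_coord n (v : 'rV[R]_n) (i : 'I_n) (t : R) : 'rV[R]_n :=
  \row_j if j == i then t else v 0 j.

Lemma set_coord_cons0 n s (p : 'rV[R]_n) t :
  set_coord (cons_rV (s, p)) ord0 t = cons_rV (t, p).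
Proof.
apply/rowP => j; rewrite mxE; case: (unliftP ord0 j) => [k ->|->].
  by rewrite !cons_rVS.
by rewrite eqxx cons_rV0.
Qed.

Lemma set_coord_consS n s (p : 'rV[R]_n) i t :
  set_coord (cons_rV (s, p)) (lift ord0 i) t = cons_rV (s, set_coord p i t).
Proof.
apply/rowP => j; rewrite mxE; case: (unliftP ord0 j) => [k ->|->].
  by rewrite !cons_rVS mxE (inj_eq lift_inj).
by rewrite !cons_rV0.
Qed.

Lemma measurable_dist_fun d1 d2 (T1 : measurableType d1) (T2 : measurableType d2)
    (f : T1 -> R) (g : T2 -> R) :
  measurable_fun setT f -> measurable_fun setT g ->
  measurable_fun setT (fun z : T1 * T2 => `|f z.1 - g z.2|%:E).
Proof.
move=> mf mg; apply/measurable_EFinP; apply: measurableT_comp => //.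
apply: measurable_funB.
  exact: (measurableT_comp mf measurable_fst).
exact: (measurableT_comp mg measurable_snd).
Qed.

Local Open Scope ereal_scope.

(* Move from x to y one coordinate at a time. *)
Lemma poincare_cube n (c : 'rV[R]_n) (r : R) (w : 'rV[R]_n -> R)
    (G : 'I_n -> 'rV[R]_n -> \bar R) : (0 < r)%R ->
  measurable_fun setT w -> (forall i, measurable_fun setT (G i)) ->
  (forall i x, 0 <= G i x) ->
  (forall i x t, ball c r x -> (`|t - c ord0 i| < r)%R ->
    `|w (set_coord x i t) - w x|%:E <=
    \int[lambda]_(s in `](c ord0 i - r)%R, (c ord0 i + r)%R[)
      G i (set_coord x i s)) ->
  \int[lebesgue_rV n]_(x in ball c r) \int[lebesgue_rV n]_(y in ball c r)
    `|w x - w y|%:E <=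
  ((r *+ 2) ^+ n.+1)%:E * \sum_(i < n) \int[lebesgue_rV n]_(x in ball c r) G i x.
Proof.
move=> r0; elim: n c w G => [|n IHn] c w G mw mG G0 wG.
  rewrite big_ord0 mule0 integral0_eq// => x _; apply: integral0_eq => y _.
  by rewrite (_ : x = y) ?subrr ?normr0//; apply/rowP => -[].
set I := `](c ord0 ord0 - r)%R, (c ord0 ord0 + r)%R[%classic.
set B := ball (tail_rV c) r.
pose mu := @lebesgue_rV R n.
pose W s p := w (cons_rV (s, p)).
(* [H p] bounds the cost of changing the first coordinate above [p]; [K p] collects the oscillation
   inside the slices of constant first coordinate. *)
pose H p := \int[lambda]_(t in I) G ord0 (cons_rV (t, p)).
pose K p := \int[lambda]_(t in I) \int[mu]_(q in B) `|W t p - W t q|%:E.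
have mI : measurable (I : set (measurableTypeR R)) by exact: measurable_itv.
have mB : measurable B by exact: measurable_ball_rV.
have lI : lambda I = (r *+ 2)%:E.
  rewrite /I lebesgue_measure_itv/= lte_fin ltrD2l gtrN//.
  by rewrite -EFinB; congr EFin; ring.
have lB : mu B = ((r *+ 2) ^+ n)%:E by exact: lebesgue_ball_rV.
have mcons := @measurable_cons_rV R n.
have mWt t : measurable_fun setT (W t).
  apply: (measurableT_comp mw); apply: (measurableT_comp mcons).
  exact: measurable_pair1.
have mF : measurable_fun setT
    (fun z : 'rV[R]_n.+1 * 'rV[R]_n.+1 => `|w z.1 - w z.2|%:E).
  exact: measurable_dist_fun.
have mH : measurable_fun setT H.
  apply: (@measurable_integral_snd _ _ _ _ _ lambda _ mI
    (fun z => G ord0 (cons_rV (z.2, z.1)))) => //.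
  apply: (measurableT_comp (mG ord0)); apply: (measurableT_comp mcons).
  exact: measurable_swap.
have mK2 : measurable_fun setT (fun z : measurableTypeR R * 'rV[R]_n =>
    \int[mu]_(q in B) `|W z.1 z.2 - W z.1 q|%:E).
  apply: (@measurable_integral_snd _ _ _ _ _ mu _ mB
    (fun z => `|W z.1.1 z.1.2 - W z.1.1 z.2|%:E)) => //.
  apply/measurable_EFinP; apply: measurableT_comp => //.
  by apply: measurable_funB; apply: (measurableT_comp mw);
    apply: (measurableT_comp mcons); apply: measurable_fun_pair => //;
    exact: measurableT_comp.
have mK : measurable_fun setT K.
  apply: (@measurable_integral_snd _ _ _ _ _ lambda _ mI
    (fun z => \int[mu]_(q in B) `|W z.2 z.1 - W z.2 q|%:E)) => //.
    exact: (measurableT_comp mK2 (@measurable_swap _ _ _ _)).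
  by move=> z; apply: integral_ge0.
have HE : \int[lebesgue_rV n.+1]_(x in ball c r) G ord0 x = \int[mu]_(p in B) H p.
  rewrite integral_ball_rVS//.
  apply: (@tonelli_set _ _ _ _ _ lambda mu I B (fun z => G ord0 (cons_rV z))) => //.
  exact: (measurableT_comp (mG ord0) mcons).
have GE i : \int[lebesgue_rV n.+1]_(x in ball c r) G (lift ord0 i) x =
    \int[lambda]_(t in I) \int[mu]_(p in B) G (lift ord0 i) (cons_rV (t, p)).
  by rewrite integral_ball_rVS.
have mGt i t : measurable_fun setT (fun p => G (lift ord0 i) (cons_rV (t, p))).
  apply: (measurableT_comp (mG _)); apply: (measurableT_comp mcons).
  exact: measurable_pair1.
have mGI i : measurable_fun setT (fun t : measurableTypeR R =>
    \int[mu]_(p in B) G (lift ord0 i) (cons_rV (t, p))).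
  apply: (@measurable_integral_snd _ _ _ _ _ mu _ mB
    (fun z => G (lift ord0 i) (cons_rV z))) => //.
  exact: measurableT_comp.
have ln0 m : (0 <= (r *+ 2) ^+ m)%R by rewrite exprn_ge0// mulrn_wge0// ltW.
(* The induction hypothesis is applied in each slice, then integrated over the first coordinate. *)
have KE : \int[mu]_(p in B) K p <= ((r *+ 2) ^+ n.+1)%:E *
    \sum_(i < n) \int[lebesgue_rV n.+1]_(x in ball c r) G (lift ord0 i) x.
  rewrite -(@tonelli_set _ _ _ _ _ lambda mu I B
    (fun z => \int[mu]_(q in B) `|W z.1 z.2 - W z.1 q|%:E))//; last first.
    by move=> z; apply: integral_ge0.
  under eq_bigr do rewrite GE.
  rewrite -ge0_integral_sum//; last 2 first.
  - by move=> k; exact: measurable_funTS.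
  - by move=> k t _; apply: integral_ge0.
  rewrite -ge0_integralZl//; last 3 first.
  - by apply: emeasurable_sum => i; exact: measurable_funTS.
  - by move=> t _; apply: sume_ge0 => i _; apply: integral_ge0.
  - by rewrite lee_fin.
  apply: ge0_le_integral => //.
  - by move=> t _; apply: integral_ge0 => p _; apply: integral_ge0.
  - apply: measurable_funTS.
    apply: (@measurable_integral_snd _ _ _ _ _ mu _ mB
      (fun z => \int[mu]_(q in B) `|W z.1 z.2 - W z.1 q|%:E)) => // z.
    by apply: integral_ge0.
  - apply: measurable_funeM.
    by apply: emeasurable_sum => i; exact: measurable_funTS.
  - move=> t It; apply: (IHn (tail_rV c) (W t)
      (fun i p => G (lift ord0 i) (cons_rV (t, p)))) => // i p s Bp.
    rewrite [tail_rV c _ _]mxE => ps; rewrite /W -set_coord_consS.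
    under eq_integral do rewrite -set_coord_consS.
    by apply: wG => //; apply/ball_cons_rV.
(* The path from (s, p) to (t, q) goes through (t, p). Its first leg costs at most [H p], a constant
   in (t, q), which the volume of the cube multiplies by (2r)^(n+1). *)
have FK s p : I s -> B p ->
    \int[lebesgue_rV n.+1]_(y in ball c r) `|W s p - w y|%:E <=
    ((r *+ 2) ^+ n.+1)%:E * H p + K p.
  move=> Is Bp.
  have H0 : 0 <= H p by apply: integral_ge0.
  have mw1 a : measurable_fun setT (fun y : 'rV[R]_n.+1 => `|a - w y|%:E).
    apply/measurable_EFinP; apply: measurableT_comp => //.
    exact: measurable_funB.
  have mW1 a t : measurable_fun setT (fun q : 'rV[R]_n => `|a - W t q|%:E).
    apply/measurable_EFinP; apply: measurableT_comp => //.
    exact: measurable_funB.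
  have mKp : measurable_fun setT (fun t : measurableTypeR R =>
      \int[mu]_(q in B) `|W t p - W t q|%:E).
    exact: (measurableT_comp mK2 (measurable_pair2 p)).
  have mFp : measurable_fun setT (fun t : measurableTypeR R =>
      \int[mu]_(q in B) `|W s p - W t q|%:E).
    apply: (@measurable_integral_snd _ _ _ _ _ mu _ mB
      (fun z => `|W s p - w (cons_rV z)|%:E)) => //.
    exact: measurableT_comp (mw1 _) mcons.
  rewrite integral_ball_rVS//.
  have -> : ((r *+ 2) ^+ n.+1)%:E * H p =
      \int[lambda]_(t in I) (((r *+ 2) ^+ n)%:E * H p).
    by rewrite integral_cst// [X in _ = _ * X]lI exprSr EFinM muleAC.
  rewrite -ge0_integralD//; last 3 first.
  - by move=> t _; rewrite mule_ge0// lee_fin.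
  - by move=> t _; apply: integral_ge0.
  - exact: measurable_funTS mKp.
  apply: ge0_le_integral => //.
  - by move=> t _; apply: integral_ge0.
  - exact: measurable_funTS mFp.
  - exact: emeasurable_funD (measurable_cst _) (measurable_funTS mKp).
  - move=> t It.
    have -> : ((r *+ 2) ^+ n)%:E * H p = \int[mu]_(q in B) H p.
      by rewrite integral_cst// [X in _ = _ * X]lB muleC.
    rewrite -ge0_integralD//; last exact: measurable_funTS (mW1 _ t).
    apply: ge0_le_integral => //.
    + exact: measurable_funTS (mW1 (W s p) t).
    + exact: emeasurable_funD (measurable_cst _) (measurable_funTS (mW1 _ t)).
    + move=> q Bq; apply: (@le_trans _ _ (`|W t p - W s p|%:E + `|W t p - W t q|%:E)).
        rewrite -EFinD lee_fin (distrC (W t p) (W s p)); exact: ler_distD.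
      rewrite leeD2r//.
      rewrite /W /H -(set_coord_cons0 s p t).
      under eq_integral do rewrite -(set_coord_cons0 s).
      apply: wG; first by apply/ball_cons_rV.
      by move: It; rewrite /I/= in_itv/= -ltr_distl.
have mL : measurable_fun setT (fun x =>
    \int[lebesgue_rV n.+1]_(y in ball c r) `|w x - w y|%:E).
  apply: (@measurable_integral_snd _ _ _ _ _ (lebesgue_rV n.+1) _
    (measurable_ball_rV c r0) (fun z => `|w z.1 - w z.2|%:E)) => //.
rewrite big_ord_recl HE integral_ball_rVS//; last first.
  by move=> x; apply: integral_ge0.
apply: (@le_trans _ _ (\int[lambda]_(s in I) \int[mu]_(p in B)
    (((r *+ 2) ^+ n.+1)%:E * H p + K p))).
  apply: ge0_le_integral => //.
  - by move=> s _; apply: integral_ge0 => p _; apply: integral_ge0.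
  - apply: measurable_funTS.
    apply: (@measurable_integral_snd _ _ _ _ _ mu _ mB (fun z =>
      \int[lebesgue_rV n.+1]_(y in ball c r) `|w (cons_rV z) - w y|%:E)).
      exact: measurableT_comp mL mcons.
    by move=> z; apply: integral_ge0.
  - move=> s Is; apply: ge0_le_integral => //.
    + by move=> p _; apply: integral_ge0.
    + apply: measurable_funTS; apply: (measurableT_comp mL).
      by apply: (measurableT_comp mcons); exact: measurable_pair1.
    + apply: measurable_funTS; apply: emeasurable_funD => //.
      exact: measurable_funeM.
    + by move=> p Bp; exact: FK.
have H0 p : 0 <= H p by apply: integral_ge0.
have K0 p : 0 <= K p by apply: integral_ge0 => t _; apply: integral_ge0.
have -> : \int[mu]_(p in B) (((r *+ 2) ^+ n.+1)%:E * H p + K p) =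
    ((r *+ 2) ^+ n.+1)%:E * \int[mu]_(p in B) H p + \int[mu]_(p in B) K p.
  rewrite -ge0_integralZl//; last 2 first.
  - exact: measurable_funTS mH.
  - by rewrite lee_fin.
  apply: ge0_integralD => //.
  - by move=> p _; rewrite mule_ge0// lee_fin.
  - exact: measurable_funeM (measurable_funTS mH).
  - exact: measurable_funTS mK.
(* The remaining integral over [s] contributes one more factor 2r, which raises the exponent to n+2
   as required in dimension n+1. *)
rewrite integral_cst// [X in _ * X]lI.
rewrite muleC (exprS _ n.+1) EFinM -muleA lee_pmul2l ?lte_fin ?mulrn_wgt0//.
have S0 : 0 <= \sum_(i < n) \int[lebesgue_rV n.+1]_(x in ball c r) G (lift ord0 i) x.
  by apply: sume_ge0 => i _; apply: integral_ge0.
have IH0 : 0 <= \int[mu]_(p in B) H p by apply: integral_ge0.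
by rewrite (ge0_muleDr _ IH0 S0) leeD2l.
Qed.
End poincare.

(** * Chains of nested sets of small oscillation *)

Section chain.
Context d (T : measurableType d) (R : realType).
Variable mu : {sigma_finite_measure set T -> \bar R}.
Variables (w : T -> R) (P : nat -> set T) (V : nat -> R) (theta t : R).
Hypothesis mw : measurable_fun setT w.
Hypothesis mP : forall k, measurable (P k).
Hypothesis PS : forall k, P k.+1 `<=` P k.
Hypothesis V0 : forall k, 0 < V k.
Hypothesis PV : forall k, mu (P k) = (V k)%:E.
Hypothesis VS : forall k, V k.+1 = theta * V k.
Hypothesis t0 : 0 < t.
Hypothesis osc : forall k,
  (\int[mu]_(x in P k) \int[mu]_(y in P k) `|w x - w y|%:E <=
   (theta * t / 4 * V k ^+ 2)%:E)%E.

(** The invariant of the induction is that [S M k] fills at least half of [P k]: the level falls by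
    only [t] at each step. *)
Let S M k := P k `&` [set x | M - k%:R * t <= w x].

Let mS M k : measurable (S M k).
Proof. by apply: measurable_fun_le => //; exact: measurable_funTS. Qed.

(** As [w] takes finite values, its superlevel sets at -m exhaust [P 0]; continuity of the measure
    yields a level reached on more than half of it. *)
Let chain0 : exists M, ((V 0 / 2)%:E <= mu (S M 0))%E.
Proof.
pose F m := S (- m%:R) 0.
have ndF : nondecreasing_seq F.
  move=> a b ab; apply/subsetPset => x [Px /= wx]; split => //=.
  by apply: le_trans wx; rewrite mul0r !subr0 lerN2 ler_nat.
have FP : \bigcup_m F m = P 0.
  apply/seteqP; split=> [x [m _ []]//|x Px].
  exists (Num.truncn `|w x|).+1 => //; split=> //=.
  rewrite mul0r subr0 lerNl (le_trans (ler_norm _))// normrN.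
  by rewrite ltW// truncnS_gt.
have : mu \o F @ \oo --> mu (\bigcup_m F m).
  by apply: nondecreasing_cvg_mu => //; [move=> m; exact: mS|rewrite FP].
rewrite FP PV => /fine_cvgP[_ FV].
have V2 : V 0 / 2 < V 0 by rewrite ltr_pdivrMr// mulr_natr mulr2n ltrDl.
have [N _ /(_ N (leqnn _)) /= NV] := cvgr_gt _ FV _ V2.
exists (- N%:R); rewrite -[leRHS]fineK; first by rewrite lee_fin ltW.
rewrite ge0_fin_numE//; apply: (@le_lt_trans _ _ (mu (P 0))).
  by apply: le_measure; rewrite ?inE//; exact: subIsetl.
by rewrite PV ltry.
Qed.

(** On [S M k] and [Q] the values of [w] are at least [t] apart, so t mu(Q) V_k/2 is at most the
    oscillation theta t V_k^2/4. Hence mu(Q) <= theta V_k/2 = V_(k+1)/2, and what [P k.+1] has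
    outside [Q] lies in [S M k.+1]. This is the origin of the constant in [osc]. *)
Let chainS M k : ((V k / 2)%:E <= mu (S M k))%E ->
  ((V k.+1 / 2)%:E <= mu (S M k.+1))%E.
Proof.
move=> Sk; pose Q := P k `&` [set x | w x < M - k.+1%:R * t].
have mQ : measurable Q.
  rewrite (_ : Q = P k `\` (P k `&` [set x | M - k.+1%:R * t <= w x])).
    apply: measurableD => //; apply: measurable_fun_le => //.
    exact: measurable_funTS.
  apply/seteqP; split=> x [Px /= wx]; split=> //; first by case; rewrite leNgt wx.
  by rewrite /= ltNge; apply/negP => wx'; exact: wx.
have QP : Q `<=` P k by exact: subIsetl.
have SP : S M k `<=` P k by exact: subIsetl.
have mF : measurable_fun setT (fun z : T * T => `|w z.1 - w z.2|%:E).
  exact: measurable_dist_fun.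
have mI : measurable_fun setT
    (fun x => \int[mu]_(y in P k) `|w x - w y|%:E)%E.
  exact: (@measurable_integral_snd _ _ _ _ _ mu _ (mP k)
    (fun z => `|w z.1 - w z.2|%:E)%E).
have mw1 a : measurable_fun setT (fun y => `|a - w y|%:E).
  apply/measurable_EFinP; apply: measurableT_comp => //.
  exact: measurable_funB.
have inner x : S M k x ->
    (t%:E * mu Q <= \int[mu]_(y in P k) `|w x - w y|%:E)%E.
  move=> [Px /= wx].
  apply: (@le_trans _ _ (\int[mu]_(y in Q) `|w x - w y|%:E)%E); last first.
    by apply: ge0_subset_integral => //; exact: measurable_funTS (mw1 (w x)).
  rewrite -integral_cst//; apply: ge0_le_integral => //.
  - by move=> y _; rewrite lee_fin ltW.
  - exact: measurable_funTS (mw1 (w x)).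
  - move=> y [_ /= wy]; rewrite lee_fin; apply: le_trans (ler_norm _).
    by move: wx wy; rewrite -natr1; lra.
have outer : (t%:E * mu Q * mu (S M k) <= (theta * t / 4 * V k ^+ 2)%:E)%E.
  apply: le_trans (osc k).
  apply: (@le_trans _ _
      (\int[mu]_(x in S M k) \int[mu]_(y in P k) `|w x - w y|%:E)%E).
    rewrite -integral_cst//; apply: ge0_le_integral => //.
    - by move=> x _; rewrite mule_ge0// lee_fin ltW.
    - exact: measurable_funTS mI.
  apply: ge0_subset_integral => //; first exact: measurable_funTS mI.
  by move=> x _; apply: integral_ge0.
have Qfin : mu Q \is a fin_num.
  rewrite ge0_fin_numE//; apply: (@le_lt_trans _ _ (mu (P k))).
    by apply: le_measure; rewrite ?inE.
  by rewrite PV ltry.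
have Q2 : (mu Q <= (V k.+1 / 2)%:E)%E.
  rewrite -(fineK Qfin) in outer *.
  have {}outer : (t%:E * (fine (mu Q))%:E * (V k / 2)%:E <=
      (theta * t / 4 * V k ^+ 2)%:E)%E.
    apply: le_trans outer; apply: lee_wpmul2l => //.
    by rewrite mule_ge0// lee_fin ?fine_ge0// ltW.
  move: outer; rewrite -!EFinM !lee_fin VS.
  have Vk := V0 k.
  rewrite (_ : theta * t / 4 * V k ^+ 2 =
    t * (theta * V k / 2) * (V k / 2)); last by field.
  by rewrite ler_pM2r ?divr_gt0// ler_pM2l.
have PE : P k.+1 `<=` S M k.+1 `|` Q.
  move=> x Px; case: (leP (M - k.+1%:R * t) (w x)) => wx; first by left.
  by right; split => //; exact: PS.
have : (mu (P k.+1) <= mu (S M k.+1) + mu Q)%E.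
  apply: le_trans (measureU2 _ _ _) => //.
  by apply: le_measure; rewrite ?inE//; exact: measurableU.
rewrite PV => PSQ.
rewrite -(@leeD2rE _ (V k.+1 / 2)%:E)//.
rewrite -EFinD -splitr; apply: le_trans PSQ _.
by rewrite leeD2l.
Qed.

Lemma oscillation_chain :
  exists M, forall k, exists2 x, P k x & M - k%:R * t <= w x.
Proof.
have [M M0] := chain0; exists M => k.
have : ((V k / 2)%:E <= mu (S M k))%E by elim: k => // k; exact: chainS.
move=> Sk; suff /set0P[x [Px wx]] : S M k != set0 by exists x.
apply/eqP => S0; move: Sk; rewrite S0 measure0 lee_fin leNgt.
by rewrite divr_gt0.
Qed.

End chain.

(** * Partial derivatives and the logarithm of a Lipschitz function *)

Section segment.
Context {R : realType} {n : nat}.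
Implicit Types (x c : 'rV[R]_n) (w : 'rV[R]_n -> R) (i : 'I_n).
Local Notation lambda := (@lebesgue_measure R).

Lemma norm_rV_le x (a : R) : 0 <= a -> (forall i, `|x 0 i| <= a) -> `|x| <= a.
Proof.
move=> a0 xa; have [x0|x0] := eqVneq `|x| 0; first by rewrite x0.
have [[j i] /= xE] := mx_norm_neq0 x0.
by rewrite -[`|x|]/(mx_norm x) xE ord1; exact: xa.
Qed.

Lemma set_coord_id x i : set_coord x i (x 0 i) = x.
Proof. by apply/rowP => j; rewrite mxE; case: eqP => // ->. Qed.

Lemma set_coord_dist x i s t : `|set_coord x i s - set_coord x i t| <= `|s - t|.
Proof.
apply: norm_rV_le => // j; rewrite !mxE; case: eqP => // _.
by rewrite subrr normr0.
Qed.

Lemma set_coord_shift x i h s :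
  h *: delta_mx ord0 i + set_coord x i s = set_coord x i (h + s).
Proof.
apply/rowP => j; rewrite !mxE eqxx/=.
by case: eqP => _; rewrite ?mulr1// mulr0 add0r.
Qed.

Lemma set_coord_ball x c r i s : ball c r x -> `|s - c ord0 i| < r ->
  ball c r (set_coord x i s).
Proof.
move=> cx sr; have r0 : 0 < r by apply: le_lt_trans sr.
apply/ball_rVP => // j; rewrite mxE; case: eqP => [->//|_].
exact: (ball_rVP _ _ r0).1 cx j.
Qed.

Lemma derive_set_coord w x i s :
  'D_1 (fun t => w (set_coord x i t)) s = 'D_(delta_mx ord0 i) w (set_coord x i s).
Proof.
rewrite /derive; under [in RHS]eq_fun do rewrite /= set_coord_shift.
by under [in LHS]eq_fun do rewrite /= [_ *: 1]mulr1.
Qed.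

Lemma measurable_set_coord x i :
  measurable_fun setT (set_coord x i : measurableTypeR R -> _).
Proof.
apply: measurable_fun_coordP => j; under eq_fun do rewrite mxE.
by case: eqP => _; [exact: measurable_id|exact: measurable_cst].
Qed.

(** Lipschitz constants are asked only on closed subintervals of the open edge, because ln |f| may
    be unbounded near the boundary of the cube. The segment between [x] and its modification is such
    a subinterval. *)
Lemma dist_le_integral_partial c r w x i t : ball c r x -> `|t - c ord0 i| < r ->
  measurable_fun (ball c r) ('D_(delta_mx ord0 i) w) ->
  (forall a b, c ord0 i - r < a -> b < c ord0 i + r -> exists L, forall s s',
    a <= s <= b -> a <= s' <= b ->
    `|w (set_coord x i s) - w (set_coord x i s')| <= L * `|s - s'|) ->
  (`|w (set_coord x i t) - w x|%:E <=
   \int[lambda]_(s in `](c ord0 i - r)%R, (c ord0 i + r)%R[)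
     `|'D_(delta_mx ord0 i) w (set_coord x i s)|%:E)%E.
Proof.
move=> cx tr mD wL.
have r0 : 0 < r by apply: le_lt_trans tr.
pose u s := w (set_coord x i s).
have xr : `|x 0 i - c ord0 i| < r by exact: (ball_rVP _ _ r0).1 cx i.
have muI : measurable_fun `]c ord0 i - r, c ord0 i + r[ ('D_1 u : measurableTypeR R -> R).
  rewrite (_ : 'D_1 u = 'D_(delta_mx ord0 i) w \o set_coord x i); last first.
    by apply/funext => s; rewrite /u derive_set_coord.
  apply: (measurable_comp _ _ mD); first exact: measurable_ball_rV.
  - move=> _ [s /= sI <-]; apply: set_coord_ball => //.
    by move: sI; rewrite in_itv/= -ltr_distl.
  - exact: measurable_funTS (measurable_set_coord x i).
suff H a b : a <= b -> c ord0 i - r < a -> b < c ord0 i + r ->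
    (`|u b - u a|%:E <= \int[lambda]_(s in `](c ord0 i - r)%R, (c ord0 i + r)%R[)
     `|'D_(delta_mx ord0 i) w (set_coord x i s)|%:E)%E.
  move: tr xr; rewrite !ltr_distl => /andP[t1 t2] /andP[x1 x2].
  rewrite -[in w x](set_coord_id x i) -/(u _) -/(u (x 0 i)).
  have [tx|/ltW xt] := leP t (x 0 i); last exact: H.
  by rewrite distrC; exact: H.
move=> ab ra br; have [L uL] := wL _ _ ra br.
have sub : `]a, b[ `<=` `]c ord0 i - r, c ord0 i + r[.
  by apply: subset_itvSoo; rewrite bnd_simp ltW.
apply: (le_trans (lipschitz_dist_le_integral_derive ab uL _)).
  exact: measurable_funS muI.
under eq_integral do rewrite derive_set_coord.
apply: ge0_subset_integral => //.
apply/measurable_EFinP; apply: measurableT_comp => //.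
apply: eq_measurable_fun muI => s _; exact: derive_set_coord.
Qed.

End segment.

Section cube.
Context {R : realType} {n : nat}.
Local Open Scope ereal_scope.

(** [poincare_cube] takes functions measurable on the whole space; [w] and its partial derivatives
    are extended by 0 outside the cube, where no integral looks. *)
Lemma poincare_cube_derive (c : 'rV[R]_n) (r : R) (w : 'rV[R]_n -> R) :
  (0 < r)%R -> {in (ball c r : set 'rV[R]_n), continuous w} ->
  (forall x i a b, ball c r x -> (c ord0 i - r < a)%R -> (b < c ord0 i + r)%R ->
    exists L, forall s s', (a <= s <= b)%R -> (a <= s' <= b)%R ->
    (`|w (set_coord x i s) - w (set_coord x i s')| <= L * `|s - s'|)%R) ->
  \int[lebesgue_rV n]_(x in ball c r) \int[lebesgue_rV n]_(y in ball c r)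
    `|w x - w y|%:E <=
  ((r *+ 2) ^+ n.+1)%:E * \sum_(i < n) \int[lebesgue_rV n]_(x in ball c r)
    `|'D_(delta_mx ord0 i) w x|%:E.
Proof.
move=> r0 cw wL; set P : set 'rV[R]_n := ball c r.
have oP : open P by exact: ball_open.
have mP : measurable P by exact: measurable_ball_rV.
have mD i : measurable_fun P ('D_(delta_mx ord0 i) w) by exact: measurable_derive_rV.
pose wp := w \_ P.
pose G i := (fun x => `|'D_(delta_mx ord0 i) w x|%:E) \_ P.
have -> : \sum_(i < n) \int[lebesgue_rV n]_(x in P) `|'D_(delta_mx ord0 i) w x|%:E =
    \sum_(i < n) \int[lebesgue_rV n]_(x in P) G i x.
  by apply: eq_bigr => i _; apply: eq_integral => x xP; rewrite /G patchE xP.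
have -> : \int[lebesgue_rV n]_(x in P) \int[lebesgue_rV n]_(y in P) `|w x - w y|%:E =
    \int[lebesgue_rV n]_(x in P) \int[lebesgue_rV n]_(y in P) `|wp x - wp y|%:E.
  apply: eq_integral => x xP; apply: eq_integral => y yP.
  by rewrite /wp !patchE xP yP.
apply: poincare_cube => //.
- apply: (measurable_restrictT w mP).1; exact: continuous_measurable_rV.
- move=> i; apply: (measurable_restrictT _ mP).1.
  by apply/measurable_EFinP; exact: measurableT_comp.
- by move=> i x; apply: erestrict_ge0.
move=> i x t Px tr.
have Pt : P (set_coord x i t) by exact: set_coord_ball.
rewrite /wp !patchE !mem_set//.
apply: le_trans (dist_le_integral_partial Px tr (mD i) (fun a b => wL x i a b Px)) _.
rewrite le_eqVlt; apply/orP; left; apply/eqP; apply: eq_integral => s.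
rewrite inE/= in_itv/= -ltr_distl => sr.
by rewrite /G patchE mem_set//; exact: set_coord_ball.
Qed.

End cube.

Section log_lipschitz.
Context {R : realType}.

(** For b <= a this is ln (1 + u) <= u at u = a/b - 1, together with 1/b <= 1/m. *)
Lemma ln_lipschitz (m a b : R) : 0 < m -> m <= a -> m <= b ->
  `|ln a - ln b| <= m^-1 * `|a - b|.
Proof.
move=> m0; wlog ba : a b / b <= a.
  move=> H ma mb; have [ba|/ltW ab] := leP b a; first exact: H.
  by rewrite distrC (distrC a); exact: H.
move=> ma mb.
have b0 : 0 < b by exact: lt_le_trans mb.
have a0 : 0 < a by exact: lt_le_trans ma.
rewrite !ger0_norm ?subr_ge0 ?ler_ln ?posrE//.
rewrite -ln_div ?posrE// (_ : a / b = 1 + (a / b - 1)); last by ring.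
apply: le_trans (le_ln1Dx _) _.
  by rewrite ltrBrDl subrr divr_gt0.
rewrite (_ : a / b - 1 = b^-1 * (a - b)); last by field; rewrite gt_eqF.
by rewrite ler_wpM2r ?subr_ge0// lef_pV2 ?posrE.
Qed.

Context {n : nat}.

Lemma continuous_ln_norm (f : 'rV[R]_n -> R) x : {for x, continuous f} ->
  f x != 0 -> {for x, continuous (fun y => ln `|f y|)}.
Proof.
move=> fx fx0.
have nfx : `|f y| @[y --> x] --> `|f x|.
  exact: cvg_comp fx (@norm_continuous _ R (f x)).
have lnx : ln y @[y --> `|f x|] --> ln `|f x|.
  by apply: continuous_ln; rewrite normr_gt0.
exact: cvg_comp nfx lnx.
Qed.

Variables (B : set 'rV[R]_n) (f : 'rV[R]_n -> R) (K : R).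
Hypothesis oB : open B.
Hypothesis f_lip : forall x y, B x -> B y -> `|f x - f y| <= K * `|x - y|.

Lemma lipschitz_continuous_in : {in B, continuous f}.
Proof.
move=> x; rewrite inE => Bx.
have FF : Filter (nbhs x) := nbhs_filter x.
apply/(@cvgrPdist_le _ _ _ (nbhs x)) => e e0.
have K1 : 0 < `|K| + 1 by rewrite ltr_pwDr.
near=> y.
have By : B y by near: y; exact: open_nbhs_nbhs.
apply: le_trans (f_lip Bx By) _.
apply: (@le_trans _ _ ((`|K| + 1) * `|x - y|)).
  by rewrite ler_wpM2r// (le_trans (ler_norm _))// lerDl.
rewrite -ler_pdivlMl//; near: y.
by apply: cvgr_dist_le => //; rewrite mulr_gt0 ?invr_gt0.
Unshelve. all: by end_near. Qed.

Hypothesis f_neq0 : forall x, B x -> f x != 0.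

(** On the compact segment |f| attains a positive minimum, and ln is Lipschitz above it with the
    inverse of that minimum as constant. *)
Lemma ln_norm_segment_lipschitz x i a b :
  (forall s, a <= s <= b -> B (set_coord x i s)) ->
  exists L, forall s s', a <= s <= b -> a <= s' <= b ->
    `|ln `|f (set_coord x i s)| - ln `|f (set_coord x i s')| | <= L * `|s - s'|.
Proof.
move=> xB; have [ab|ba] := leP a b; last first.
  by exists 0 => s s' /andP[/le_trans h /h]; rewrite leNgt ba.
pose g s := `|f (set_coord x i s)|.
have Bs s : s \in `[a, b] -> B (set_coord x i s) by rewrite in_itv/=; exact: xB.
have cg : {within `[a, b], continuous g}.
  apply: continuous_in_subspaceT => s; rewrite inE => /Bs sB.
  have cs : set_coord x i t @[t --> s] --> set_coord x i s.
    apply/cvgrPdist_le => e e0; near=> t.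
    apply: le_trans (set_coord_dist _ _ _ _) _.
    by near: t; exact: cvgr_dist_le.
  have cf : f y @[y --> set_coord x i s] --> f (set_coord x i s).
    by apply: lipschitz_continuous_in; rewrite inE.
  have cfs : f (set_coord x i t) @[t --> s] --> f (set_coord x i s).
    exact: cvg_comp cs cf.
  exact: cvg_comp cfs (@norm_continuous _ R _).
have [s0 /Bs s0B gmin] := EVT_min ab cg.
have m0 : 0 < g s0 by rewrite normr_gt0 f_neq0.
exists ((g s0)^-1 * `|K|) => s s' sab s'ab.
apply: (le_trans (ln_lipschitz m0 _ _)).
- by apply: gmin; rewrite in_itv.
- by apply: gmin; rewrite in_itv.
rewrite -mulrA ler_wpM2l ?invr_ge0 ?(ltW m0)//.
apply: le_trans (ler_dist_dist _ _) _.
apply: le_trans (f_lip (xB _ sab) (xB _ s'ab)) _.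
apply: (@le_trans _ _ (`|K| * `|set_coord x i s - set_coord x i s'|)).
  by rewrite ler_wpM2r// ler_norm.
by rewrite ler_wpM2l// set_coord_dist.
Unshelve. all: by end_near. Qed.

End log_lipschitz.

(** * From the integral of the p-th power to the oscillation on a cube *)

Section power.
Context {R : realType}.

(** When y > eps, the second term is y (y/eps)^(p-1), which is at least y since p >= 1. *)
Lemma le_eps_powR (p eps y : R) : 1 <= p -> 0 < eps -> 0 <= y ->
  y <= eps + eps `^ (1 - p) * y `^ p.
Proof.
move=> p1 e0 y0; have [ye|ey] := leP y eps.
  by rewrite (le_trans ye)// lerDl mulr_ge0 ?powR_ge0.
have yp : 0 < y by exact: lt_trans ey.
suff : y <= eps `^ (1 - p) * y `^ p by move=> /le_trans; apply; rewrite lerDr ltW.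
rewrite -(mulr_powRB1 y0); last exact: lt_le_trans p1.
rewrite mulrCA ler_peMr//.
rewrite -opprB powRN -ler_pdivrMl ?invr_gt0 ?powR_gt0// invrK mulr1.
by rewrite ge0_ler_powR ?subr_ge0// ?nnegrE ltW.
Qed.

Lemma coord_le_euclidean_norm n (v : 'rV[R]_n) i :
  `|v ord0 i| <= euclidean_norm v.
Proof.
rewrite -sqrtr_sqr ler_wsqrtr// (bigD1 i)//= lerDl.
by apply: sumr_ge0 => j _; exact: sqr_ge0.
Qed.

Lemma measurable_euclidean_gradient n (B : set 'rV[R]_n) w : open B ->
  {in B, continuous w} ->
  measurable_fun B (fun x => euclidean_norm (gradient w x)).
Proof.
move=> oB cw; apply: (measurableT_comp (f := @Num.sqrt R)).
  by apply: continuous_measurable_fun; exact: sqrt_continuous.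
apply: measurable_sum => i; under eq_fun do rewrite mxE.
by apply: measurable_funX; exact: measurable_derive_rV.
Qed.

Local Open Scope ereal_scope.

(** Of the factor l^(n+1) given by Poincare, one l joins a, so that [le_eps_powR] applies to l a.
    Its two terms integrate to at most l^n eps, by the volume, and l^n eps^(1-p) j, by l^p <= l^n.
    The total carries exactly the squared volume l^(2n), so the bound on the mean oscillation is
    uniform in l. *)
Lemma cube_oscillation n (c : 'rV[R]_n) (r : R) (w : 'rV[R]_n -> R) (p eps j : R) :
  (0 < r)%R -> (r *+ 2 <= 1)%R -> (1 <= p)%R -> (n%:R <= p)%R -> (0 < eps)%R ->
  {in (ball c r : set 'rV[R]_n), continuous w} ->
  (forall x i a b, ball c r x -> (c ord0 i - r < a)%R -> (b < c ord0 i + r)%R ->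
    exists L, forall s s', (a <= s <= b)%R -> (a <= s' <= b)%R ->
    (`|w (set_coord x i s) - w (set_coord x i s')| <= L * `|s - s'|)%R) ->
  \int[lebesgue_rV n]_(x in ball c r)
    (euclidean_norm (gradient w x) `^ p)%:E <= j%:E ->
  \int[lebesgue_rV n]_(x in ball c r) \int[lebesgue_rV n]_(y in ball c r)
    `|w x - w y|%:E <=
  (n%:R * (eps + eps `^ (1 - p) * j) * ((r *+ 2) ^+ n) ^+ 2)%:E.
Proof.
move=> r0 r1 p1 np e0 cw wL Hj.
set P : set 'rV[R]_n := ball c r.
set l : R := (r *+ 2)%R.
pose a x := euclidean_norm (gradient w x).
have l0 : (0 < l)%R by rewrite mulrn_wgt0.
have oP : open P by exact: ball_open.
have mP : measurable P by exact: measurable_ball_rV.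
have PE : lebesgue_rV n P = (l ^+ n)%:E by exact: lebesgue_ball_rV.
have ma : measurable_fun P a by exact: measurable_euclidean_gradient.
have a0 x : (0 <= a x)%R by exact: sqrtr_ge0.
have map : measurable_fun P (fun x => a x `^ p)%R.
  exact: (measurableT_comp (measurable_powR p) ma).
apply: (le_trans (poincare_cube_derive r0 cw wL)).
have Da i : \int[lebesgue_rV n]_(x in P) `|'D_(delta_mx ord0 i) w x|%:E <=
    \int[lebesgue_rV n]_(x in P) (a x)%:E.
  apply: ge0_le_integral => //.
  - by apply/measurable_EFinP; apply: measurableT_comp => //; exact: measurable_derive_rV.
  - exact/measurable_EFinP.
  - move=> x _; rewrite lee_fin.
    by have := coord_le_euclidean_norm (gradient w x) i; rewrite mxE.
apply: (@le_trans _ _ ((l ^+ n.+1)%:E *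
    (n%:R%:E * \int[lebesgue_rV n]_(x in P) (a x)%:E))).
  rewrite lee_wpmul2l ?lee_fin ?exprn_ge0 ?(ltW l0)//.
  apply: le_trans (lee_sum _ (fun i _ => Da i)) _.
  by rewrite sumr_const card_ord mule_natl.
have -> : (l ^+ n.+1)%:E * (n%:R%:E * \int[lebesgue_rV n]_(x in P) (a x)%:E) =
    (l ^+ n * n%:R)%:E * \int[lebesgue_rV n]_(x in P) (l * a x)%:E.
  under [in RHS]eq_integral do rewrite EFinM.
  rewrite ge0_integralZl//; last 3 first.
  - exact/measurable_EFinP.
  - by move=> x _; rewrite lee_fin.
  - by rewrite lee_fin ltW.
  by rewrite !muleA -!EFinM; congr (_%:E * _); rewrite exprSr; ring.
have lp : (l `^ p <= l ^+ n)%R.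
  by rewrite -powR_mulrn ?(ltW l0)// ger_powR// l0.
have lint : \int[lebesgue_rV n]_(x in P) (l * a x)%:E <=
    (eps * l ^+ n + eps `^ (1 - p) * l ^+ n * j)%:E.
  apply: (@le_trans _ _ (\int[lebesgue_rV n]_(x in P)
      (eps%:E + (eps `^ (1 - p) * l `^ p)%:E * (a x `^ p)%:E))).
    apply: ge0_le_integral => //.
    - by move=> x _; rewrite lee_fin mulr_ge0// ltW.
    - by apply/measurable_EFinP; exact: measurable_funM.
    - apply: emeasurable_funD => //; apply: measurable_funeM.
      exact/measurable_EFinP.
    - move=> x _; rewrite -EFinM -EFinD lee_fin -mulrA -powRM// ?(ltW l0)//.
      by apply: le_eps_powR => //; rewrite mulr_ge0// ltW.
  have -> : \int[lebesgue_rV n]_(x in P)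
      (eps%:E + (eps `^ (1 - p) * l `^ p)%:E * (a x `^ p)%:E) =
      \int[lebesgue_rV n]_(x in P) eps%:E +
      \int[lebesgue_rV n]_(x in P)
        ((eps `^ (1 - p) * l `^ p)%:E * (a x `^ p)%:E).
    apply: ge0_integralD => //.
    - by move=> x _; rewrite lee_fin ltW.
    - by move=> x _; rewrite -EFinM lee_fin !mulr_ge0// powR_ge0.
    - by apply: measurable_funeM; exact/measurable_EFinP.
  rewrite integral_cst// [X in eps%:E * X]PE -EFinM EFinD leeD2l//.
  rewrite ge0_integralZl//; last 3 first.
  - exact/measurable_EFinP.
  - by move=> x _; rewrite lee_fin powR_ge0.
  - by rewrite lee_fin mulr_ge0// powR_ge0.
  have j0 : (0 <= j)%R.
    rewrite -lee_fin; apply: le_trans Hj; apply: integral_ge0 => x _.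
    by rewrite lee_fin powR_ge0.
  apply: (@le_trans _ _ ((eps `^ (1 - p) * l `^ p)%:E * j%:E)).
    by rewrite lee_wpmul2l// lee_fin mulr_ge0// powR_ge0.
  by rewrite -EFinM lee_fin ler_wpM2r// ler_wpM2l// powR_ge0.
apply: (@le_trans _ _ ((l ^+ n * n%:R)%:E *
    (eps * l ^+ n + eps `^ (1 - p) * l ^+ n * j)%:E)).
  by rewrite lee_wpmul2l// lee_fin mulr_ge0// exprn_ge0// ltW.
by rewrite -EFinM lee_fin le_eqVlt; apply/orP; left; apply/eqP; ring.
Qed.
End power.

(** * Cubes shrinking to a zero *)

Section shrinking_cubes.
Context {R : realType} {n : nat}.
Variables (f : 'rV[R]_n -> R) (p K rho : R) (y z : 'rV[R]_n).
Hypothesis n0 : (0 < n)%N.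
Hypothesis np : n%:R <= p.
Hypothesis rho0 : 0 < rho.
Hypothesis zy : `|z - y| = rho.
Hypothesis fz : f z = 0.
Hypothesis f_neq0 : forall x, ball y rho x -> f x != 0.
Hypothesis f_lip : forall x x', ball y rho x -> ball y rho x' ->
  `|f x - f x'| <= K * `|x - x'|.
Hypothesis f_lipz : forall x, ball y rho x -> `|f x - f z| <= K * `|x - z|.

Let B : set 'rV[R]_n := ball y rho.
(** Since [|z - y| = rho], the distance from z to [c k] is exactly [r k]: z stays on the boundary of
    every [P k]. *)
Let c k : 'rV[R]_n := z + 2 ^- k *: (y - z).
Let r k : R := rho * 2 ^- k.
Let P k : set 'rV[R]_n := ball (c k) (r k).
Let w x := ln `|f x|.
Let h x : \bar R := (euclidean_norm (gradient w x) `^ p)%:E.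

Let ball_norm (a : 'rV[R]_n) e x : ball a e x = (`|a - x| < e) :> Prop.
Proof. by rewrite -ball_normE. Qed.

Let r_gt0 k : 0 < r k. Proof. by rewrite mulr_gt0// invr_gt0 exprn_gt0. Qed.

Let rS k : r k.+1 = r k / 2.
Proof. by rewrite /r exprS invfM mulrA mulrAC. Qed.

Let normyz : `|y - z| = rho. Proof. by rewrite distrC. Qed.

Let P0 : P 0 = B.
Proof. by rewrite /P /c /r expr0 invr1 scale1r mulr1 addrC subrK. Qed.

(** The centres are [r k.+1] apart and [r k] is twice [r k.+1], so the balls are internally
    tangent. *)
Let PS k : P k.+1 `<=` P k.
Proof.
move=> x; rewrite /P !ball_norm => xk.
apply: le_lt_trans (ler_distD (c k.+1) _ _) _.
have -> : `|c k - c k.+1| = r k.+1.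
  rewrite /c opprD addrACA subrr add0r -scalerBl normrZ normyz mulrC.
  rewrite ger0_norm.
    by congr (_ * _); rewrite exprS invfM; field.
  by rewrite subr_ge0 lef_pV2 ?posrE ?exprn_gt0// exprS ler_peMl// ?exprn_ge0// ler1n.
by rewrite (_ : r k = r k.+1 + r k.+1) ?ltrD2l// rS -splitr.
Qed.

Let PB k : P k `<=` B.
Proof. by rewrite -P0; elim: k => // k IH x /PS /IH. Qed.

Let P_near k x : P k x -> `|x - z| < r k *+ 2.
Proof.
rewrite /P ball_norm => xk; rewrite distrC.
apply: le_lt_trans (ler_distD (c k) _ _) _.
rewrite mulr2n ler_ltD// /c opprD addNKr normrN normrZ normyz mulrC.
by rewrite ger0_norm// invr_ge0 exprn_ge0.
Qed.

Let oB : open B. Proof. exact: ball_open. Qed.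
Let mB : measurable B. Proof. exact: measurable_ball_rV. Qed.
Let mP k : measurable (P k). Proof. exact: measurable_ball_rV. Qed.

Let cw : {in B, continuous w}.
Proof.
move=> x xB; apply: continuous_ln_norm; first exact: (lipschitz_continuous_in oB f_lip).
by apply: f_neq0; rewrite inE in xB.
Qed.

Let mh : measurable_fun B h.
Proof.
apply/measurable_EFinP; apply: (measurableT_comp (measurable_powR p)).
exact: measurable_euclidean_gradient.
Qed.

Let h0 x : (0 <= h x)%E. Proof. by rewrite lee_fin powR_ge0. Qed.

Let r_cvg0 : r k @[k --> \oo] --> 0.
Proof.
rewrite -[X in _ --> X](mulr0 rho).
apply: cvgM; first exact: cvg_cst.
under eq_fun do rewrite -exprVn.
by apply: cvg_expr; rewrite ger0_norm ?invr_ge0// invf_lt1// ltr1n.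
Qed.

(** Dominated convergence with [h] as the bound: a point x of [B] differs from z because f x <> 0 =
    f z, and it has left [P k] once 2 r_k < |x - z|. *)
Lemma integral_shrink_cvg0 : (\int[lebesgue_rV n]_(x in B) h x < +oo)%E ->
  (\int[lebesgue_rV n]_(x in P k) h x)%E @[k --> \oo] --> 0%E.
Proof.
move=> hoo.
have ih : (lebesgue_rV n).-integrable B h.
  apply/integrableP; split=> //.
  by under eq_integral do rewrite gee0_abs//.
have mhk k : measurable_fun B (h \_ (P k)).
  apply/(measurable_restrict h (mP k) mB).
  exact: measurable_funS mB (@subIsetl _ _ _) mh.
have hk0 x : B x -> (h \_ (P k)) x @[k --> \oo] --> 0%E.
  move=> Bx; apply: cvg_near_cst.
  have xz : 0 < `|x - z|.
    rewrite normr_gt0 subr_eq0; apply/eqP => xz.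
    by have := f_neq0 Bx; rewrite xz fz eqxx.
  have xz2 : 0 < `|x - z| / 2 by rewrite divr_gt0.
  near=> k.
  rewrite patchE; case: ifPn => //; rewrite inE => /P_near.
  have : r k < `|x - z| / 2 by near: k; exact: cvgr_lt r_cvg0 _ xz2.
  by move=> rx xr; exfalso; move: rx xr; lra.
have hkh x k : B x -> (`|(h \_ (P k)) x| <= h x)%E.
  by move=> Bx; rewrite patchE; case: ifP => _; rewrite ?gee0_abs ?abse0.
have [|||_ _] := @dominated_convergence _ _ _ (lebesgue_rV n) B mB
  (fun k => h \_ (P k)) (cst 0%E) h mhk _ _ ih _.
- exact: measurable_cst.
- by apply: aeW => x Bx; exact: hk0.
- by apply: aeW => x k Bx; exact: hkh.
rewrite integral0; apply: cvg_trans; apply: near_eq_cvg; near=> k.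
by rewrite /= -integral_mkcondr setIidr//; exact: PB.
Unshelve. all: by end_near. Qed.

Lemma gradient_ln_not_integrable :
  ~ (\int[lebesgue_rV n]_(x in B) h x < +oo)%E.
Proof.
move=> hoo.
have p1 : 1 <= p by apply: le_trans np; rewrite ler1n.
have n1 : 0 < n%:R :> R by rewrite ltr0n.
pose t : R := ln 2 / 2.
have t0 : 0 < t by rewrite divr_gt0// ln_gt0// ltr1n.
(* [theta] is the ratio of consecutive volumes and [eta] the oscillation allowed by the chain; [eps]
   and [j] make both terms of [cube_oscillation] equal to [eps], with 2 n eps = eta. *)
pose theta : R := 2 ^- n.
have theta0 : 0 < theta by rewrite invr_gt0 exprn_gt0.
pose eta := theta * t / 4.
have eta0 : 0 < eta by rewrite divr_gt0// mulr_gt0.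
pose eps := eta / (2 * n%:R).
have eps0 : 0 < eps by rewrite divr_gt0// mulr_gt0.
pose j := eps / eps `^ (1 - p).
have j0 : 0 < j by rewrite divr_gt0// powR_gt0.
have etaE : n%:R * (eps + eps `^ (1 - p) * j) = eta.
  rewrite /j mulrCA divff ?mulr1; last by rewrite gt_eqF// powR_gt0.
  by rewrite /eps; field; rewrite gt_eqF.
(* The chain starts at the index [N] from which the cubes have side at most 1 and carry an integral
   of at most [j]. *)
have [N [rN jN]] : exists N, (forall k, (N <= k)%N -> r k *+ 2 <= 1) /\
    (forall k, (N <= k)%N -> (\int[lebesgue_rV n]_(x in P k) h x <= j%:E)%E).
  have /fine_cvgP[ffin fcvg] := integral_shrink_cvg0 hoo.
  have half0 : 0 < 2^-1 :> R by rewrite invr_gt0.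
  have : \forall k \near \oo, r k *+ 2 <= 1 /\
      (\int[lebesgue_rV n]_(x in P k) h x <= j%:E)%E.
    near=> k; split.
      have : r k < 2^-1 by near: k; exact: cvgr_lt r_cvg0 _ half0.
      by move=> rk; rewrite mulr2n; lra.
    rewrite -[leLHS]fineK; last by near: k.
    by rewrite lee_fin; near: k; exact: cvgr_le fcvg _ j0.
  by move=> [N _ HN]; exists N; split=> k /HN [].
pose wp := w \_ B.
pose V k := (r (k + N) *+ 2) ^+ n.
have [M MP] : exists M, forall k, exists2 x, P (k + N) x & M - k%:R * t <= wp x.
  apply: (@oscillation_chain _ _ _ (lebesgue_rV n) wp (fun k => P (k + N)) V theta) => //.
  - apply: (measurable_restrictT w mB).1; exact: continuous_measurable_rV.
  - by move=> k; exact: PS.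
  - by move=> k; rewrite exprn_gt0// mulrn_wgt0.
  - by move=> k; exact: lebesgue_ball_rV.
  - by move=> k; rewrite /V addSn rS /theta -exprVn -exprMn -mulrnAl mulrC.
  - move=> k; rewrite -/eta.
    have wpE : (\int[lebesgue_rV n]_(x in P (k + N)) \int[lebesgue_rV n]_(y in P (k + N))
        `|wp x - wp y|%:E = \int[lebesgue_rV n]_(x in P (k + N))
        \int[lebesgue_rV n]_(y in P (k + N)) `|w x - w y|%:E)%E.
      apply: eq_integral => x; rewrite inE => /PB Bx.
      apply: eq_integral => x'; rewrite inE => /PB Bx'.
      by rewrite /wp !patchE !mem_set.
    rewrite wpE -etaE; apply: cube_oscillation => //.
    - by apply: rN; rewrite leq_addl.
    - by move=> x; rewrite inE => /PB Bx; apply: cw; rewrite inE.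
    - move=> x i a b Px ar br; apply: (ln_norm_segment_lipschitz oB f_lip f_neq0).
      move=> s /andP[as_ sb]; apply: (@PB (k + N)); apply: set_coord_ball => //.
      by rewrite ltr_distl (lt_le_trans ar)//= (le_lt_trans sb).
    - by apply: jN; rewrite leq_addl.
pose K' := `|K| + 1.
have K'0 : 0 < K' by rewrite ltr_pwDr.
(* |f x| = |f x - f z| is at most K' |x - z|, and |x - z| < 2 rho 2^-k; [K'] is positive so that its
   logarithm is meaningful. *)
have wle k x : P k x -> w x <= ln (K' * rho * 2) - k%:R * ln 2.
  move=> Px; have Bx := PB Px.
  have fx0 : 0 < `|f x| by rewrite normr_gt0 f_neq0.
  have fx : `|f x| <= K' * rho * 2 / 2 ^+ k.
    rewrite -[f x]subr0 -fz; apply: le_trans (f_lipz Bx) _.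
    apply: (@le_trans _ _ (K' * `|x - z|)).
      by rewrite ler_wpM2r// (le_trans (ler_norm _))// lerDl.
    rewrite -!mulrA ler_pM2l// (le_trans (ltW (P_near Px)))//.
    by rewrite /r mulr2n le_eqVlt; apply/orP; left; apply/eqP; ring.
  rewrite mulr_natl -lnXn// -ln_div ?posrE ?exprn_gt0 ?mulr_gt0//.
  by rewrite ler_ln ?posrE// divr_gt0 ?exprn_gt0 ?mulr_gt0.
(* Both bounds are read in [P (k + N)]: the lower one falls by t per step, the upper one by ln 2 = 2
   t, and the extra N ln 2 >= 0 is dropped. Large k then gives the contradiction. *)
have H k : k%:R * t <= ln (K' * rho * 2) - M.
  have [x Px] := MP k.
  have Bx : B x by exact: PB Px.
  rewrite /wp patchE mem_set// => Mx.
  have := wle _ _ Px; rewrite natrD mulrDl.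
  have : 0 <= N%:R * ln 2 :> R by rewrite mulr_ge0// ln_ge0// ler1n.
  move: Mx; rewrite /t; lra.
set C := _ - M in H.
have := H (Num.truncn (C / t)).+1.
rewrite leNgt -ltr_pdivrMr// => /negP; apply.
by rewrite truncnS_gt.
Unshelve. all: by end_near. Qed.
End shrinking_cubes.

(** * A zero-free cube touching the zero set *)

Section touching_ball.
Context {R : realType} {n : nat}.
Implicit Types (Omega : set 'rV[R]_n) (f : 'rV[R]_n -> R).

Lemma locally_lipschitz_ball Omega f x : open Omega ->
  locally_lipschitz Omega f -> Omega x ->
  exists2 r, 0 < r & ball x r `<=` Omega /\ exists K, forall y z,
    ball x r y -> ball x r z -> `|f y - f z| <= K * `|y - z|.
Proof.
move=> oO fL Ox; have [U Ux [M [_ HM]]] := fL x Ox.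
have : nbhs x (U `&` Omega) by apply: filterI => //; exact: open_nbhs_nbhs.
move=> /nbhs_ballP[r /= r0 rU]; exists r => //; split; first by move=> y /rU [].
exists (M + 1) => y z /rU yU /rU zU.
by apply: (HM (M + 1) _ (y, z)); [rewrite ltrDl|split].
Qed.

Lemma locally_lipschitz_continuous Omega f : open Omega ->
  locally_lipschitz Omega f -> {in Omega, continuous f}.
Proof.
move=> oO fL x; rewrite inE => Ox.
have [r r0 [_ [K fK]]] := locally_lipschitz_ball oO fL Ox.
have /(_ x) := @lipschitz_continuous_in _ _ (ball x r) f K (ball_open x r) fK.
by apply; rewrite inE; exact: ballxx.
Qed.

Lemma nbhs_neq0 f x : {for x, continuous f} -> f x != 0 ->
  nbhs x [set t | f t != 0].
Proof.
move=> cfx fx; apply: (cfx [set t | t != 0]).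
by apply: open_nbhs_nbhs; split=> //; exact: open_neq.
Qed.

(** Otherwise every zero is interior to the zero set, so the zeros in the component of x0 form a
    nonempty relatively open and closed subset. By connectedness f vanishes on the whole component,
    against non-constancy. *)
Lemma zero_set_boundary Omega f x0 : open Omega -> {in Omega, continuous f} ->
  zero_set Omega f x0 -> nonconstant_on (connected_component Omega x0) f ->
  exists z0, [/\ Omega z0, f z0 = 0 &
    forall r, 0 < r -> exists2 y, ball z0 r y & f y != 0].
Proof.
move=> oO cf [Ox0 fx0] [a [b [Ca Cb fab]]].
apply/not_existsP => H.
pose C := connected_component Omega x0.
have CO : C `<=` Omega by exact: connected_component_sub.
have zero_open z : Omega z -> f z = 0 -> nbhs z [set y | f y = 0].
  move=> Oz fz; apply/not_notP => nz; apply: (H z); split=> // r r0.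
  apply/not_exists2P => nr; apply: nz; apply/nbhs_ballP; exists r => //= y yr.
  by have [//|/negP/negPn/eqP] := nr y.
have E : C `&` [set y | f y = 0] = C.
  apply: (@component_connected _ Omega x0).
  - by exists x0; split=> //; exact: connected_component_refl.
  - exists (Omega `&` [set y | f y = 0]); last first.
      by rewrite setIA (setIidl CO).
    rewrite openE => y [Oy fy]; apply: filterI; last exact: zero_open.
    exact: open_nbhs_nbhs.
  - exists (~` (Omega `&` [set y | f y != 0])).
      apply: open_closedC; rewrite openE => y [Oy /= fy]; apply: filterI.
        exact: open_nbhs_nbhs.
      have cfy : f t @[t --> y] --> f y by apply: cf; rewrite inE.
      exact: (nbhs_neq0 cfy).
    apply/seteqP; split=> y [Cy]; first by move=> /= fy; split=> // -[_ /=]; rewrite fy eqxx.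
    move=> nfy; split=> //=; apply/eqP; apply: contra_notT nfy => fy.
    by split=> //; exact: CO.
have f0 x : C x -> f x = 0 by rewrite -E => -[].
by apply: fab; rewrite !f0.
Qed.

(** Take y with f y <> 0 within r/4 of z0, and z a zero nearest to y among those within r/2 of z0.
    Then rho <= |z0 - y| < r/4, so a zero in the ball of radius rho about y would compete in the
    minimum and beat z. *)
Lemma touching_ball f z0 r K : 0 < r -> f z0 = 0 ->
  (forall y z, ball z0 r y -> ball z0 r z -> `|f y - f z| <= K * `|y - z|) ->
  (forall e, 0 < e -> exists2 y, ball z0 e y & f y != 0) ->
  exists y rho z, [/\ 0 < rho, `|z - y| = rho, f z = 0, ball z0 r z &
    ball y rho `<=` ball z0 r /\ forall x, ball y rho x -> f x != 0].
Proof.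
move=> r0 fz0 fK fn0.
have r4 : 0 < r / 4 by rewrite divr_gt0.
have [y yr fy] := fn0 _ r4.
have bE (a : 'rV[R]_n) e x : ball a e x = (`|a - x| < e) :> Prop.
  by rewrite -ball_normE.
(* The closed ball of radius r/2 stays inside the open ball where f is continuous, so limits of
   zeros in [A] are again zeros and [A] is compact. *)
pose A := [set x : 'rV[R]_n | `|z0 - x| <= r / 2 /\ f x = 0].
have Ab x : A x -> ball z0 r x.
  by move=> [xr _]; rewrite bE (le_lt_trans xr)//; lra.
have cf := @lipschitz_continuous_in _ _ (ball z0 r) f K (ball_open z0 r) fK.
have cA : compact A.
  apply: bounded_closed_compact.
    exists (`|z0| + r / 2); split; first exact: num_real.
    move=> M rM x [xr _]; apply: ltW; apply: le_lt_trans rM.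
    rewrite -[x in `|x|](subrK z0) addrC; apply: le_trans (ler_normD _ _) _.
    by rewrite lerD2l distrC.
  move=> x clx; have xr : `|z0 - x| <= r / 2.
    rewrite leNgt; apply/negP => rx.
    have d0 : 0 < `|z0 - x| - r / 2 by rewrite subr_gt0.
    have [a [[ar _]]] := clx _ (nbhsx_ballx x _ d0); rewrite bE => xa.
    have := ler_distD a z0 x; rewrite (distrC a x); lra.
  split=> //; apply/eqP/negPn/negP => fx.
  have cfx : f t @[t --> x] --> f x.
    by apply: cf; rewrite inE bE (le_lt_trans xr)//; lra.
  by have [a [[_ fa]]] := clx _ (nbhs_neq0 cfx fx); rewrite /= fa eqxx.
have A0 : A !=set0 by exists z0; split=> //; rewrite subrr normr0; lra.
have cn : {within A, continuous (fun x => `|x - y|)}.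
  apply: continuous_subspaceT => x.
  apply: (@lipschitz_continuous_in _ _ setT _ 1 openT); last by rewrite inE.
  move=> u v _ _; rewrite mul1r (le_trans (ler_dist_dist _ _))//.
  by rewrite opprB addrA subrK.
have [z] := EVT_min_rV A0 cA cn; rewrite inE => Az zmin.
exists y, `|z - y|, z; split => //.
- rewrite normr_gt0 subr_eq0; apply/eqP => zyE.
  by move: fy; rewrite -zyE; case: Az => _ ->; rewrite eqxx.
- by case: Az.
- exact: Ab.
have zy : `|z - y| < r / 4.
  apply: le_lt_trans (zmin z0 _) _; last by rewrite bE in yr.
  by rewrite inE; split=> //; rewrite subrr normr0; lra.
have bA x : ball y `|z - y| x -> `|z0 - x| <= r / 2.
  rewrite bE => yx; apply: le_trans (ler_distD y _ _) _.
  by rewrite bE in yr; lra.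
split=> x xB; first by rewrite bE (le_lt_trans (bA _ xB))//; lra.
apply/eqP => fx; have := zmin x; rewrite inE => /(_ (conj (bA _ xB) fx)).
by rewrite leNgt => /negP; apply; rewrite bE distrC in xB.
Qed.
End touching_ball.

Unset Implicit Arguments.

Theorem corollary1p4 (R : realType) (n : nat) (Omega : set 'rV[R]_n)
    (f : 'rV[R]_n -> R) (p : R)
    (Omega_open : open Omega)
    (f_lip : locally_lipschitz Omega f)
    (f_zero : exists2 x0, zero_set Omega f x0 &
      nonconstant_on (connected_component Omega x0) f)
    (f_int : (\int[lebesgue_rV n]_(x in Omega `\` zero_set Omega f)
      (euclidean_norm (gradient (fun y => ln `|f y|) x) `^ p)%:E < +oo)%E) :
  p < n%:R.
Proof.
rewrite ltNge; apply/negP => np.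
have [x0 x0Z fnc] := f_zero.
(* R^0 has a single point, on which nothing is non-constant; n > 0 then yields p >= 1. *)
have n0 : (0 < n)%N.
  rewrite lt0n; apply/eqP => n0; have [a [b [_ _ fab]]] := fnc.
  apply: fab; congr (f _); apply/rowP => i.
  suff : (0 < n)%N by move=> /lt0n_neq0/eqP/(_ n0).
  exact: leq_ltn_trans (ltn_ord i).
have cf := locally_lipschitz_continuous Omega_open f_lip.
have [z0 [Oz0 fz0 fn0]] := zero_set_boundary Omega_open cf x0Z fnc.
have [r r0 [rO [K fK]]] := locally_lipschitz_ball Omega_open f_lip Oz0.
have [y [rho [z [rho0 zy fz zr [yr yn0]]]]] := touching_ball r0 fz0 fK fn0.
apply: (@gradient_ln_not_integrable _ _ f p K rho y z) => //.
- by move=> x x' xB xB'; apply: fK; exact: yr.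
- by move=> x xB; apply: fK => //; exact: yr.
pose D := Omega `&` [set x | f x != 0].
have DE : Omega `\` zero_set Omega f = D.
  apply/seteqP; split=> x [Ox fx]; split=> //=; first by apply/eqP => fx0; exact: fx.
  by move=> [_ fx0]; move: fx => /=; rewrite fx0 eqxx.
(* Bounding the integral over the ball by the one over [D] requires the integrand to be measurable
   on all of [D], which comes from [D] being open and ln |f| continuous on it. *)
have oD : open D.
  rewrite openE => x [Ox fx]; apply: filterI; first exact: open_nbhs_nbhs.
  by apply: nbhs_neq0 => //; apply: cf; rewrite inE.
have cw : {in D, continuous (fun y => ln `|f y|)}.
  move=> x; rewrite inE => -[Ox fx]; apply: continuous_ln_norm => //.
  by apply: cf; rewrite inE.
rewrite DE in f_int; apply: le_lt_trans f_int.
apply: ge0_subset_integral => //.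
- exact: measurable_ball_rV.
- exact: open_measurable_rV.
- apply/measurable_EFinP; apply: (measurableT_comp (measurable_powR p)).
  exact: measurable_euclidean_gradient.
- by move=> x _; rewrite lee_fin powR_ge0.
- by move=> x xB; split; [exact/rO/yr|exact: yn0].
Qed.
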